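(* Let $(X,\mathcal{T},(I_i)_{i\in\mathbb{N}})$ be a computable topological space, let $S$ be a semicomputable set in this space and let $x\in S$. Suppose that there exists a neighborhood of $x$ in $S$ which is homeomorphic to $\mathbb{R}^n$ for some $n\in\mathbb{N}\setminus\{0\}$. Then $S$ is c.e. at $x$.
   Context: Fix a computably finite valued function $j\mapsto[j]$ from $\mathbb{N}$ onto the nonempty finite subsets of $\mathbb{N}$ ($\{(j,i): i\in[j]\}$ computable and $[j]\subseteq\{0,\dots,\varphi(j)\}$ for a computable $\varphi$). A computable topological space is a triple $(X,\mathcal{T},(I_i))$ with $(X,\mathcal{T})$ a topological space, $\{I_i\}\subseteq\mathcal{T}$ a basis, and c.e. sets $\mathcal{C},\mathcal{D}\subseteq\mathbb{N}^2$ such that: (1) $(i,j)\in\mathcal{D}\Rightarrow I_i\cap I_j=\emptyset$; (2) $(i,j)\in\mathcal{C}\Rightarrow I_i\subseteq I_j$; (3) for $x\neq y$ there are $i,j$ with $x\in I_i$, $y\in I_j$, $(i,j)\in\mathcal{D}$; (4) if $x\in I_i\cap I_j$ there is $k$ with $x\in I_k$ and $(k,i),(k,j)\in\mathcal{C}$. Let $J_j=\bigcup_{i\in[j]}I_i$. A compact set $S$ is semicomputable if $\{j: S\subseteq J_j\}$ is c.e. For $A\subseteq S\subseteq X$, $A$ is c.e. up to $S$ if there is a c.e. $\Omega\subseteq\mathbb{N}$ such that for each $i$: $I_i\cap A\neq\emptyset\Rightarrow i\in\Omega$, and $i\in\Omega\Rightarrow I_i\cap S\neq\emptyset$. For $x\in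 S$, $S$ is c.e. at $x$ if there is a neighborhood $N$ of $x$ in $S$ (subspace topology) which is c.e. up to $S$. *)

(* Defs.v *)
From HB Require Import structures.
From mathcomp Require Import all_boot all_order all_algebra.
From mathcomp Require Import all_classical all_reals all_analysis.

Set Implicit Arguments.
Unset Strict Implicit.
Unset Printing Implicit Defensive.

Import numFieldNormedType.Exports.
Local Open Scope classical_set_scope.

(* Descriptions of the k-ary partial (mu-)recursive functions. *)
Inductive recf : nat -> Type :=
| RZero k : recf k
| RSucc : recf 1
| RProj k (i : 'I_k) : recf k
| RComp k m (f : recf m) (g : 'I_m -> recf k) : recf k
| RPrec k (f : recf k) (g : recf k.+2) : recf k.+1
| RMu k (f : recf k.+1) : recf k.

(* [rec_eval c v y] : the partial function described by c is defined at v, with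
   value y.  The recursion variable is the head of the argument tuple:
     h (0, w) = f w,  h (i + 1, w) = g (i, h (i, w), w),
   and [s] lists the values h (0, w), ..., h (n, w).  Minimization requires
   f (i, v) to be defined and nonzero for every i < y. *)
Fixpoint rec_eval k (c : recf k) {struct c} : k.-tuple nat -> nat -> Prop :=
  match c in recf k return k.-tuple nat -> nat -> Prop with
  | RZero _ => fun _ y => y = 0
  | RSucc => fun v y => y = (thead v).+1
  | RProj _ i => fun v y => y = tnth v i
  | RComp _ m f g => fun v y =>
      exists2 w : m.-tuple nat,
        forall i, rec_eval (g i) v (tnth w i) & rec_eval f w y
  | RPrec _ f g => fun v y =>
      let w := [tuple of behead v] in
      exists s : nat -> nat,
        [/\ rec_eval f w (s 0),
            forall i, i < thead v ->
              rec_eval g [tuple of i :: s i :: w] (s i.+1)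
          & y = s (thead v)]
  | RMu _ f => fun v y =>
      rec_eval f [tuple of y :: v] 0 /\
      forall i, i < y -> exists z, rec_eval f [tuple of i :: v] z.+1
  end.

Definition computable_fun (f : nat -> nat) : Prop :=
  exists c : recf 1, forall n, rec_eval c [tuple n] (f n).

(* Computability of a subset of N^2: its characteristic function is total
   recursive. *)
Definition computable_set2 (A : set (nat * nat)) : Prop :=
  exists c : recf 2, forall i j, rec_eval c [tuple i; j] `[< A (i, j) >].

(* Computably enumerable sets, as domains of partial recursive functions. *)
Definition ce_set (A : set nat) : Prop :=
  exists c : recf 1, forall n, A n <-> exists y, rec_eval c [tuple n] y.

Definition ce_set2 (A : set (nat * nat)) : Prop :=
  exists c : recf 2,
    forall i j, A (i, j) <-> exists y, rec_eval c [tuple i; j] y.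

(* The set [j] is [fs j]. *)
Definition cfv_enumeration (fs : nat -> set nat) : Prop :=
  [/\ computable_set2 [set p | fs p.1 p.2],
      exists2 phi : nat -> nat,
        computable_fun phi & forall j i, fs j i -> i <= phi j
    & range fs = [set A | finite_set A /\ A !=set0]].

Section computable_topology.
Context {X : topologicalType}.
Implicit Types (I : nat -> set X) (A N S : set X) (x : X).

Definition computable_topological_space I : Prop :=
  basis (range I) /\
  exists C D : set (nat * nat),
    [/\ ce_set2 C, ce_set2 D &
    [/\ forall i j, D (i, j) -> I i `&` I j = set0,
        forall i j, C (i, j) -> I i `<=` I j,
        forall x y, x <> y -> exists i j, [/\ I i x, I j y & D (i, j)]
      & forall i j x, (I i `&` I j) x ->
          exists k, [/\ I k x, C (k, i) & C (k, j)]]].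

Definition finite_union I (fs : nat -> set nat) (j : nat) : set X :=
  \bigcup_(i in fs j) I i.

Definition semicomputable I (fs : nat -> set nat) S : Prop :=
  compact S /\ ce_set [set j | S `<=` finite_union I fs j].

Definition ce_up_to I A S : Prop :=
  A `<=` S /\
  exists2 Omega : set nat, ce_set Omega &
    forall i, (I i `&` A !=set0 -> Omega i) /\ (Omega i -> I i `&` S !=set0).

(* Neighborhood of x in the subspace S, not necessarily open in S. *)
Definition nbhd_in S x N : Prop :=
  [/\ S x, N `<=` S & nbhs (x : subspace S) N].

Definition ce_at I S x : Prop :=
  exists2 N : set X, nbhd_in S x N & ce_up_to I N S.

(* A, with the subspace topology, is homeomorphic to the (inhabited) space Y;
   f matters only on A. *)
Definition homeomorphic_to A (Y : topologicalType) : Prop :=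
  exists (f : X -> Y) (g : Y -> X),
    [/\ {within A, continuous f}, continuous g,
        forall y, A (g y), forall a, A a -> g (f a) = a & cancel g f].

End computable_topology.

(* Main.v *)
Require Import Defs.
From mathcomp Require Import all_boot all_order all_algebra.
From mathcomp Require Import all_classical all_reals all_analysis.
From mathcomp Require Import zify lra.
Import numFieldNormedType.Exports.
Local Open Scope classical_set_scope.

(** Let [g : R^n -> S] parametrize a neighborhood of [x = g c] and put around [c]
    concentric cubes of radii [r], [2r], [3r].  A basic set [I_i] is enumerated
    when finitely many basic sets are found that cover [S] and consist of [I_i],
    of members of a fixed cover [w] of the part of [S] outside the largest cube
    (disjoint from the image of the middle cube), and, for each coordinate [k],
    of two formally disjoint families which are formally disjoint from fixed
    covers of the opposite faces [z_k = c_k + 2r] and [z_k = c_k - 2r].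

    If [I_i] meets the image of the smallest cube at [g y], such a family is
    obtained by covering the images of [z_k <= y_k - e] and [z_k >= y_k + e].
    Conversely, if [I_i] missed [S], the middle cube would be covered by [n] pairs
    of disjoint open sets, the k-th pair separating the k-th faces, which is
    impossible (a form of the Lebesgue covering theorem).  The latter is proved on
    a fine grid with coefficients in F_2: the cup product of the coboundaries of
    [n] functions equal to 0 and 1 on the respective faces sums to 1 over the
    grid cubes, so on some grid cube none of these functions is constant. *)

Set Implicit Arguments.
Unset Strict Implicit.
Unset Printing Implicit Defensive.

(** * Recursive functions and computably enumerable sets *)

(** Functions act on plain lists, so that changes of arity need no casts between tuple types; only
    the values on lists of length [k] matter. *)
Definition comp k (F : seq nat -> nat) : Prop :=
  exists c : recf k, forall v : k.-tuple nat, rec_eval c v (F v).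

Lemma comp_ext k F G :
  (forall v, size v = k -> F v = G v) -> comp k F -> comp k G.
Proof. by move=> FG [c hc]; exists c => v; rewrite -FG ?size_tuple. Qed.

Lemma comp_var k i : comp k (fun v => nth 0 v i).
Proof.
have [ik|ki] := ltnP i k.
  by exists (RProj (Ordinal ik)) => v /=; rewrite (tnth_nth 0).
by exists (RZero k) => v /=; rewrite nth_default // size_tuple.
Qed.

Lemma comp_subst m k F (G : nat -> seq nat -> nat) :
  comp m F -> (forall i, i < m -> comp k (G i)) ->
  comp k (fun v => F [seq G i v | i <- iota 0 m]).
Proof.
move=> [c hc] hG.
have /choice[g hg] : forall i : 'I_m, exists g : recf k,
    forall v : k.-tuple nat, rec_eval g v (G i v).
  by move=> i; apply: hG.
exists (RComp c g) => v /=.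
have sz : size [seq G i v | i <- iota 0 m] == m by rewrite size_map size_iota.
exists (Tuple sz); last exact: (hc (Tuple sz)).
move=> i; rewrite (tnth_nth 0) /= (nth_map 0) ?size_iota // nth_iota //.
Qed.

Lemma comp_subst1 k F G1 : comp 1 F -> comp k G1 -> comp k (fun v => F [:: G1 v]).
Proof.
move=> hF h1.
by apply: (comp_subst (G := fun _ => G1) hF) => -[].
Qed.

Lemma comp_subst2 k F G1 G2 :
  comp 2 F -> comp k G1 -> comp k G2 -> comp k (fun v => F [:: G1 v; G2 v]).
Proof.
move=> hF h1 h2.
by apply: (comp_subst (G := fun i => if i is 0 then G1 else G2) hF) => -[|[]].
Qed.

Lemma comp_subst3 k F G1 G2 G3 :
  comp 3 F -> comp k G1 -> comp k G2 -> comp k G3 ->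
  comp k (fun v => F [:: G1 v; G2 v; G3 v]).
Proof.
move=> hF h1 h2 h3.
by apply: (comp_subst
  (G := fun i => match i with 0 => G1 | 1 => G2 | _ => G3 end) hF) => -[|[|[]]].
Qed.

Lemma map_nth_iota_tuple k (v : seq nat) d : size v = d + k ->
  [seq nth 0 v (d + i) | i <- iota 0 k] = drop d v.
Proof.
move=> sv; apply: (@eq_from_nth _ 0).
  by rewrite size_map size_iota size_drop sv; lia.
move=> i; rewrite size_map size_iota => ik.
by rewrite (nth_map 0) ?size_iota // nth_iota // nth_drop.
Qed.

(** Dropping, swapping and duplicating leading arguments are all instances; the arguments behind the
    first [d] serve as parameters. *)
Lemma comp_args k d (Gs : seq (seq nat -> nat)) F :
  (forall i, i < size Gs -> comp (d + k) (nth (fun=> 0) Gs i)) ->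
  comp (size Gs + k) F ->
  comp (d + k) (fun v => F ([seq G v | G <- Gs] ++ drop d v)).
Proof.
move=> hG hF; pose H i :=
  if i < size Gs then nth (fun=> 0) Gs i else fun v => nth 0 v (d + (i - size Gs)).
apply: comp_ext (comp_subst (G := H) hF _) => [v sv|i _]; last first.
  by rewrite /H; case: ltnP => ?; [exact: hG|exact: comp_var].
congr F; apply: (@eq_from_nth _ 0).
  by rewrite size_cat !size_map size_iota size_drop sv; lia.
move=> i; rewrite size_map size_iota => ik.
rewrite (nth_map 0) ?size_iota // nth_iota // nth_cat size_map /H add0n.
by case: ltnP => h; [rewrite (nth_map (fun=> 0))|rewrite nth_drop].
Qed.

Lemma comp_cons k d F G : comp k.+1 F -> comp (d + k) G ->
  comp (d + k) (fun v => F (G v :: drop d v)).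
Proof. by move=> hF hG; apply: (@comp_args k d [:: G]) => // -[]. Qed.

Lemma comp_drop k d F : comp k F -> comp (d + k) (fun v => F (drop d v)).
Proof. by move=> hF; apply: (@comp_args k d [::]). Qed.

Lemma comp_const k n : comp k (fun=> n).
Proof.
elim: n => [|n ih]; first by exists (RZero k).
have hs : comp 1 (fun v => (nth 0 v 0).+1).
  by exists RSucc => v; rewrite /= /thead (tnth_nth 0).
exact: (comp_subst1 hs ih).
Qed.

Lemma comp_S k G : comp k G -> comp k (fun v => (G v).+1).
Proof.
have hs : comp 1 (fun v => (nth 0 v 0).+1).
  by exists RSucc => v; rewrite /= /thead (tnth_nth 0).
exact: comp_subst1 hs.
Qed.

Fixpoint primrec (F G : seq nat -> nat) (n : nat) (w : seq nat) : nat :=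
  if n is i.+1 then G [:: i, primrec F G i w & w] else F w.

Lemma comp_primrec k F G : comp k F -> comp k.+2 G ->
  comp k.+1 (fun v => primrec F G (head 0 v) (behead v)).
Proof.
move=> [f hf] [g hg]; exists (RPrec f g) => v /=.
exists (fun i => primrec F G i (behead v)); split.
- exact: (hf [tuple of behead v]).
- move=> i _.
  exact: (hg [tuple of i :: primrec F G i (behead v) :: [tuple of behead v]]).
- by case/tupleP: v => n v /=; rewrite theadE.
Qed.

Lemma comp_primrec_at k F G H : comp k F -> comp k.+2 G -> comp k H ->
  comp k (fun v => primrec F G (H v) v).
Proof.
move=> hF hG hH.
have := @comp_cons k 0 _ _ (comp_primrec hF hG) hH.
by apply: comp_ext => v _ /=; rewrite drop0.
Qed.

Definition ifz (a b c : nat) : nat := if a is 0 then b else c.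

Lemma comp_ifz k A B C : comp k A -> comp k B -> comp k C ->
  comp k (fun v => ifz (A v) (B v) (C v)).
Proof.
move=> hA hB hC.
have h3 : comp 3 (fun v => ifz (nth 0 v 0) (nth 0 v 1) (nth 0 v 2)).
  have := comp_primrec (comp_var 2 0) (comp_var 4 3).
  by apply: comp_ext => -[|[|a] [|b [|c []]]].
exact: (comp_subst3 h3 hA hB hC).
Qed.

Lemma comp_pred k A : comp k A -> comp k (fun v => (A v).-1).
Proof.
have h1 : comp 1 (fun v => (nth 0 v 0).-1).
  have := comp_primrec (comp_const 0 0) (comp_var 2 0).
  by apply: comp_ext => -[|[|a] []].
exact: comp_subst1 h1.
Qed.

Lemma comp_add k A B : comp k A -> comp k B -> comp k (fun v => A v + B v).
Proof.
have h2 : comp 2 (fun v => nth 0 v 0 + nth 0 v 1).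
  have := comp_primrec (comp_var 1 0) (comp_S (comp_var 3 1)).
  apply: comp_ext => -[|a [|b []]] //= _.
  by elim: a => //= a ->.
exact: comp_subst2 h2.
Qed.

Lemma comp_mul k A B : comp k A -> comp k B -> comp k (fun v => A v * B v).
Proof.
have h2 : comp 2 (fun v => nth 0 v 0 * nth 0 v 1).
  have := comp_primrec (comp_const 1 0) (comp_add (comp_var 3 2) (comp_var 3 1)).
  apply: comp_ext => -[|a [|b []]] //= _.
  by elim: a => //= a ->.
exact: comp_subst2 h2.
Qed.

Lemma comp_prod (T : Type) (r : seq T) k (G : T -> seq nat -> nat) :
  (forall i, comp k (G i)) -> comp k (fun v => \prod_(i <- r) G i v).
Proof.
move=> hG; elim: r => [|i r ih].
  by apply: comp_ext (comp_const k 1) => v _; rewrite big_nil.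
by apply: comp_ext (comp_mul (hG i) ih) => v _; rewrite big_cons.
Qed.

Lemma comp_eq k A B : comp k A -> comp k B -> comp k (fun v => A v == B v : nat).
Proof.
move=> hA hB.
(* The recursion runs on the subtrahend, which therefore comes first. *)
have sub2 : comp 2 (fun v => nth 0 v 1 - nth 0 v 0).
  have := comp_primrec (comp_var 1 0) (comp_pred (comp_var 3 1)).
  apply: comp_ext => -[|a [|b []]] //= _.
  by elim: a => [|a /= ->]; rewrite ?subn0 // subnS.
have hd := comp_add (comp_subst2 sub2 hA hB) (comp_subst2 sub2 hB hA).
apply: comp_ext (comp_ifz hd (comp_const k 1) (comp_const k 0)) => v _ /=.
case: eqP => [->|ab]; first by rewrite subnn.
have : 0 < B v - A v + (A v - B v) by lia.
by case: (B v - A v + (A v - B v)).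
Qed.

(** * Step-bounded evaluation *)

Definition step_monotone (e : seq nat -> nat) : Prop :=
  forall m m' v y, m <= m' -> e (m :: v) = y.+1 -> e (m' :: v) = y.+1.

(* [e] evaluates [c] with step bound m, the head of its argument: the value is 0
   if no result is found, and y.+1 if the result is y. *)
Definition normal_form k (c : recf k) (e : seq nat -> nat) : Prop :=
  [/\ comp k.+1 e, step_monotone e &
    forall (v : k.-tuple nat) y, rec_eval c v y <-> exists m, e (m :: v) = y.+1].

Lemma normal_form_total k (c : recf k) F :
  comp k F -> (forall v : k.-tuple nat, forall y, rec_eval c v y <-> y = F v) ->
  normal_form c (fun v => (F (behead v)).+1).
Proof.
move=> hF hc; split => //.
- apply: comp_S; apply: comp_ext (comp_drop 1 hF) => v _.
  by rewrite drop1.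
- move=> v y /=; split; first by move=> /hc ->; exists 0.
  by case=> _ [<-]; apply/hc.
Qed.

Lemma normal_form_uniq k (c : recf k) e : normal_form c e ->
  forall v y y', rec_eval c v y -> rec_eval c v y' -> y = y'.
Proof.
case=> _ emono he v y y' /he[m em] /he[m' em'].
have := emono _ _ _ _ (leq_maxl m m') em.
by rewrite (emono _ _ _ _ (leq_maxr m m') em') => -[].
Qed.

(** All evaluations share one step bound. The outer one is run only if the product of the inner ones
    is nonzero, that is, if all of them have ended. *)
Lemma normal_form_RComp k m (f : recf m) (g : 'I_m -> recf k) ef
    (eg : 'I_m -> seq nat -> nat) :
  normal_form f ef -> (forall i, normal_form (g i) (eg i)) ->
  exists e, normal_form (RComp f g) e.
Proof.
move=> [cef mef hef] heg.
pose ws v := [seq (eg i v).-1 | i <- enum 'I_m].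
pose e v := ifz (\prod_(i <- enum 'I_m) eg i v) 0 (ef (head 0 v :: ws v)).
have szw v : size (ws v) == m by rewrite size_map size_enum_ord.
have eP v y : e v = y.+1 <->
    (forall i, 0 < eg i v) /\ ef (head 0 v :: ws v) = y.+1.
  rewrite /e; have [p0|pN] := posnP (\prod_(i <- enum 'I_m) eg i v).
    rewrite p0 /=; split => // -[pos _]; move: p0.
    suff : 0 < \prod_(i <- enum 'I_m) eg i v by case: (\prod_(_ <- _) _).
    by apply: prodn_gt0 => i; apply: pos.
  rewrite /ifz; case ep : (\prod_(i <- enum 'I_m) eg i v) pN => [//|p] _.
  split => [h|[]//]; split => // i; rewrite lt0n; apply/eqP => ei.
  by move: ep; rewrite (big_rem i) ?mem_enum //= ei mul0n.
exists e; split.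
- apply: comp_ifz; [|exact: comp_const|].
    by apply: comp_prod => i; case: (heg i).
  pose H i v := if i is i'.+1 then nth 0 (ws v) i' else nth 0 v 0.
  apply: (@comp_ext _ (fun v => ef [seq H i v | i <- iota 0 m.+1])).
    move=> v _; congr ef; rewrite /= -nth0; congr (_ :: _).
    rewrite -[1]/(1 + 0) iotaDl -map_comp /= -[RHS]drop0.
    by rewrite -(@map_nth_iota_tuple m) // (eqP (szw v)).
  apply: comp_subst => // -[|i] im; first exact: comp_var.
  pose j := Ordinal (im : i < m).
  have [cj _ _] := heg j.
  apply: comp_ext (comp_pred cj) => v _ /=.
  by rewrite (nth_map j) ?size_enum_ord //  (nth_ord_enum j j).
- move=> a b v y ab /eP[pos /= efy]; apply/eP.
  have E i : eg i (b :: v) = eg i (a :: v).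
    have [_ mi _] := heg i; have := pos i.
    by case Ei : (eg i (a :: v)) => [|z] // _; apply: mi Ei.
  split => [i|/=]; first by rewrite E.
  rewrite (_ : ws (b :: v) = ws (a :: v)); first exact: mef efy.
  by apply: eq_map => i; rewrite E.
- move=> v y /=; split.
  + case=> w hw /hef[m0 hm0].
    have /choice[M hM] : forall i, exists m, eg i (m :: v) = (tnth w i).+1.
      by move=> i; have [_ _ hi] := heg i; apply/hi/hw.
    pose b := maxn m0 (\max_i M i).
    have Eb i : eg i (b :: v) = (tnth w i).+1.
      have [_ mi _] := heg i; apply: mi (hM i).
      by rewrite leq_max; apply/orP; right; apply: leq_bigmax.
    exists b; apply/eP; split => [i|/=]; first by rewrite Eb.
    rewrite (_ : ws (b :: v) = w); first by apply: mef hm0; rewrite leq_maxl.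
    apply: (@eq_from_nth _ 0); first by rewrite size_tuple (eqP (szw _)).
    move=> i; rewrite (eqP (szw _)) => im; pose j := Ordinal im.
    rewrite (nth_map j) ?size_enum_ord // (nth_ord_enum j j) Eb /=.
    by rewrite (tnth_nth 0).
  + case=> a /eP[pos /= efy]; exists (Tuple (szw (a :: v))).
      move=> i; have [_ _ hi] := heg i; apply/hi; exists a.
      rewrite (tnth_nth 0) /= (nth_map i) ?size_enum_ord //.
      by rewrite nth_ord_enum prednK.
    by apply/hef; exists a.
Qed.

(** The value 0, read as unfinished, is absorbing under [G], so a finished stage [n] has only
    finished stages below it. *)
Lemma primrec_neq0 F G n w :
  (forall i, G [:: i, 0 & w] = 0) -> primrec F G n w != 0 ->
  forall i, i <= n -> primrec F G i w != 0.
Proof.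
move=> G0; elim: n => [|n ih] h i; first by rewrite leqn0 => /eqP ->.
rewrite leq_eqVlt => /predU1P[-> //|]; rewrite ltnS; apply: ih.
by apply: contraNneq h => /= ->; rewrite G0.
Qed.

Lemma normal_form_RPrec k (f : recf k) (g : recf k.+2) ef eg :
  normal_form f ef -> normal_form g eg -> exists e, normal_form (RPrec f g) e.
Proof.
move=> [cf mf hf] [cg mg hg].
(* The arguments of [G'] are the recursion index, the previous value shifted by one, the step bound,
   and the parameters. *)
pose G' v := ifz (nth 0 v 1) 0
  (eg ([:: nth 0 v 2; nth 0 v 0; (nth 0 v 1).-1] ++ drop 3 v)).
pose h n m w := primrec ef G' n (m :: w).
have hS n m w : h n.+1 m w =
    ifz (h n m w) 0 (eg [:: m, n, (h n m w).-1 & w]).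
  by rewrite /h /= /G' /= drop0.
have hmono n m m' w y : m <= m' -> h n m w = y.+1 -> h n m' w = y.+1.
  move=> mm'; elim: n y => [|n ih] y; first exact: mf.
  rewrite !hS; case E: (h n m w) => [//|z] /= egy.
  by rewrite (ih _ E) /=; apply: mg egy.
exists (fun v => h (nth 0 v 1) (nth 0 v 0) (drop 2 v)); split.
- have cG : comp k.+3 G'.
    apply: comp_ifz; [exact: comp_var|exact: comp_const|].
    apply: (@comp_args k 3 [:: fun v => nth 0 v 2; fun v => nth 0 v 0;
      fun v => (nth 0 v 1).-1]) => // -[|[|[|//]]] _ /=;
      [exact: comp_var|exact: comp_var|exact/comp_pred/comp_var].
  have cH := comp_primrec cf cG.
  by apply: (@comp_args k 2 [:: fun v => nth 0 v 1; fun v => nth 0 v 0] _ _ cH)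
    => -[|[|//]] _ /=; apply: comp_var.
- by move=> m m' [|n v] y mm' /=; apply: hmono.
- move=> v y; case/tupleP: v => n w; rewrite /= drop0 theadE.
  split.
  + case=> s [/hf[m0 hm0] hs ->].
    suff [m hm] : exists m, h n m w = (s n).+1 by exists m.
    suff H i : i <= n -> exists m, h i m w = (s i).+1 by apply: H.
    elim: i => [_|i ih lin]; first by exists m0.
    have [m hm] := ih (ltnW lin).
    have /hg[m' hm'] := hs i lin; rewrite /= in hm'.
    exists (maxn m m'); rewrite hS (hmono _ _ _ _ _ (leq_maxl m m') hm) /=.
    exact: mg (leq_maxr m m') hm'.
  + case=> m hm; exists (fun i => (h i m w).-1).
    have nz i : i <= n -> h i m w != 0.
      apply: primrec_neq0; first by move=> j; rewrite /G' /=.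
      by rewrite -/(h n m w) hm.
    split; last by rewrite hm.
    * by apply/hf; exists m; rewrite prednK // lt0n; apply: nz.
    * move=> i lin; apply/hg; exists m; rewrite /=.
      have := nz _ lin; have := nz _ (ltnW lin); rewrite hS.
      by case: (h i m w) => //= z _; case: (eg _).
Qed.

Lemma monotone_uniform_bound (Q : nat -> nat -> Prop) n :
  (forall m m' i, m <= m' -> Q m i -> Q m' i) ->
  (forall i, i < n -> exists m, Q m i) ->
  exists m, forall i, i < n -> Q m i.
Proof.
move=> mono; elim: n => [|n ih] h; first by exists 0.
have [m hm] := ih (fun i lin => h i (ltnW lin)).
have [m' hm'] := h n (ltnSn n).
exists (maxn m m') => i; rewrite ltnS leq_eqVlt => /predU1P[->|lin].
  exact: mono (leq_maxr m m') hm'.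
exact: mono (leq_maxl m m') (hm _ lin).
Qed.

Lemma normal_form_RMu k (f : recf k.+1) ef :
  normal_form f ef -> exists e, normal_form (RMu f) e.
Proof.
move=> [cf mf hf].
(* The search state: 0 = still searching, 1 = stuck, y + 2 = found y. *)
pose st' (i r s : nat) := ifz s (ifz r 1 (ifz r.-1 i.+2 0)) s.
pose G' v := st' (nth 0 v 0) (ef ([:: nth 0 v 2; nth 0 v 0] ++ drop 3 v)) (nth 0 v 1).
pose st n m w := primrec (fun=> 0) G' n (m :: w).
have stS n m w : st n.+1 m w = st' n (ef [:: m, n & w]) (st n m w).
  by rewrite /st /= /G' /= drop0.
have stP n m w : (st n m w = 0 <-> forall i, i < n -> 1 < ef [:: m, i & w]) /\
    forall y, st n m w = y.+2 <-> [/\ y < n, ef [:: m, y & w] = 1 &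
      forall i, i < y -> 1 < ef [:: m, i & w]].
  elim: n => [|n [ih0 ihS]]; first by split=> [//|y]; split=> // -[].
  rewrite stS; case E: (st n m w) => [|s] /=.
    have {}ih0 := ih0.1 E; case Er: (ef _) => [|[|r]] /=.
    - split=> [|y]; split=> //.
        by move=> /(_ n (ltnSn n)); rewrite Er.
      case; rewrite ltnS leq_eqVlt => /predU1P[->|yn]; first by rewrite Er.
      by move: (ih0 _ yn) => + h; rewrite h.
    - split=> [|y]; split=> //.
      + by move=> /(_ n (ltnSn n)); rewrite Er.
      + by move=> [<-].
      + case; rewrite ltnS leq_eqVlt => /predU1P[->//|yn].
        by move: (ih0 _ yn) => + h; rewrite h.
    - split=> [|y]; split=> //.
      + move=> _ i; rewrite ltnS leq_eqVlt => /predU1P[->|]; last exact: ih0.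
        by rewrite Er.
      + case; rewrite ltnS leq_eqVlt => /predU1P[->|yn]; first by rewrite Er.
        by move: (ih0 _ yn) => + h; rewrite h.
  split=> [|y]; split=> //.
  - move=> h; have /ih0 : forall i, i < n -> 1 < ef [:: m, i & w].
      by move=> i lin; apply/h/ltnW.
    by rewrite E.
  - by rewrite -E => /ihS[yn ey hy]; split=> //; apply: ltnW.
  - case; rewrite ltnS leq_eqVlt => /predU1P[->|yn] ey hy.
      by move/ih0 : hy; rewrite E.
    by rewrite -E; apply/ihS.
(* The bound limits both the number of candidates and the length of each evaluation. The predecessor
   sends the states 0 and 1 to no result, and y + 2 to y + 1. *)
exists (fun v => (st (nth 0 v 0) (nth 0 v 0) (drop 1 v)).-1); split.
- have cG : comp k.+3 G'.
    have cr : comp k.+3 (fun v => ef ([:: nth 0 v 2; nth 0 v 0] ++ drop 3 v)).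
      apply: (@comp_args k 3 [:: fun v => nth 0 v 2; fun v => nth 0 v 0]) => //.
      by move=> -[|[|//]] _; apply: comp_var.
    have c1 := comp_var k.+3 1; have c0 := comp_const k.+3 0.
    apply: (comp_ifz c1 _ c1); apply: (comp_ifz cr (comp_const _ _)).
    by apply: (comp_ifz (comp_pred cr) _ c0); do 2!apply: comp_S; apply: comp_var.
  apply: comp_pred.
  by apply: (@comp_args k 1 [:: fun v => nth 0 v 0; fun v => nth 0 v 0] _ _
     (comp_primrec (comp_const _ 0) cG)) => -[|[|//]] _; apply: comp_var.
- move=> m m' v y mm' /=; rewrite drop0.
  case E: (st m m v) => [//|s] /= sy; rewrite {s}sy in E.
  have [ym ey hy] := ((stP _ _ _).2 _).1 E.
  suff -> : st m' m' v = y.+2 by [].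
  apply/(stP _ _ _).2; split; [exact: leq_trans mm'|exact: mf ey|].
  move=> i iy; have := hy i iy; case Ei: (ef _) => [//|z].
  by rewrite (mf _ _ _ _ mm' Ei).
- move=> v y /=; rewrite drop0; split.
  + case=> /hf[m0 hm0] hy.
    have [m1 hm1] : exists m, forall i, i < y -> 1 < ef [:: m, i & v].
      apply: monotone_uniform_bound => [m m' i mm'|i /hy[z /hf[m hm]]].
        by case Ei: (ef _) => [//|z]; rewrite (mf _ _ _ _ mm' Ei).
      by exists m; rewrite /= in hm; rewrite hm.
    exists (maxn y.+1 (maxn m0 m1)); set M := maxn _ _.
    suff -> : st M M v = y.+2 by [].
    apply/(stP _ _ _).2; split; first by rewrite /M; lia.
      by apply: (mf _ _ _ _ _ hm0); rewrite /M; lia.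
    move=> i /hm1; case Ei: (ef _) => [//|z].
    by rewrite (mf _ M _ _ _ Ei) // /M; lia.
  + case=> m; case E: (st m m v) => [//|s] /= sy; rewrite {s}sy in E.
    have [ym ey hy] := ((stP _ _ _).2 _).1 E; split; first by apply/hf; exists m.
    move=> i /hy; case Ei: (ef _) => [//|[//|z]] _; exists z; apply/hf.
    by exists m.
Qed.

(** A form of Kleene's normal form theorem, with step bounds in place of codes of computations. *)
Theorem normal_form_exists k (c : recf k) : exists e, normal_form c e.
Proof.
elim: c => {k} [k||k i|k m f [ef hf] g hg|k f [ef hf] g [eg hg]|k f [ef hf]].
- by eexists; apply: (normal_form_total (comp_const k 0)).
- eexists; apply: (normal_form_total (comp_S (comp_var 1 0))) => v y /=.
  by rewrite /thead (tnth_nth 0).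
- eexists; apply: (normal_form_total (comp_var k i)) => v y /=.
  by rewrite (tnth_nth 0).
- have /choice[eg {}hg] := hg; exact: normal_form_RComp hf hg.
- exact: normal_form_RPrec hf hg.
- exact: normal_form_RMu hf.
Qed.

Lemma rec_eval_functional k (c : recf k) v y y' :
  rec_eval c v y -> rec_eval c v y' -> y = y'.
Proof. by have [e he] := normal_form_exists c; apply: normal_form_uniq he _ _ _. Qed.

(** * Closure properties of Sigma_1 predicates *)

Section sigma1.
Implicit Types P Q : seq nat -> Prop.

(** The head of the list is a stage; monotonicity allows finitely many stages to be merged into
    their maximum. *)
Definition sigma1 k P : Prop := exists T, [/\ comp k.+1 T,
  forall m m' v, m <= m' -> 0 < T (m :: v) -> 0 < T (m' :: v) &
  forall v, size v = k -> (P v <-> exists m, 0 < T (m :: v))].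

Lemma comp_bounded_sum k T B : comp k.+1 T -> comp k B ->
  comp k (fun v => \sum_(0 <= a < B v) T (a :: v)).
Proof.
move=> cT cB.
have cG : comp k.+2 (fun v => nth 0 v 1 + T (nth 0 v 0 :: drop 2 v)).
  by apply: comp_add (comp_var _ _) (@comp_cons k 2 _ _ cT (comp_var _ _)).
apply: comp_ext (comp_primrec_at (comp_const k 0) cG cB) => v _.
elim: (B v) => [|b /= ->]; first by rewrite big_nil.
by rewrite drop0 big_nat_recr.
Qed.

Lemma comp_bounded_prod k T B : comp k.+1 T -> comp k B ->
  comp k (fun v => \prod_(0 <= a < B v) T (a :: v)).
Proof.
move=> cT cB.
have cG : comp k.+2 (fun v => nth 0 v 1 * T (nth 0 v 0 :: drop 2 v)).
  by apply: comp_mul (comp_var _ _) (@comp_cons k 2 _ _ cT (comp_var _ _)).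
apply: comp_ext (comp_primrec_at (comp_const k 1) cG cB) => v _.
elim: (B v) => [|b /= ->]; first by rewrite big_nil.
by rewrite drop0 big_nat_recr.
Qed.

Lemma sigma1_eq k A B : comp k A -> comp k B -> sigma1 k (fun v => A v = B v).
Proof.
move=> cA cB; exists (fun v => A (drop 1 v) == B (drop 1 v) : nat); split.
- by apply: comp_eq; apply: (@comp_drop k 1).
- by move=> m m' v _ /=; rewrite !drop0.
- move=> v _ /=; rewrite drop0; split=> [->|[_]]; first by exists 0; rewrite eqxx.
  by rewrite lt0b => /eqP.
Qed.

Lemma sigma1_and k P Q : sigma1 k P -> sigma1 k Q -> sigma1 k (fun v => P v /\ Q v).
Proof.
move=> [T [cT mT hT]] [U [cU mU hU]]; exists (fun v => T v * U v); split.
- exact: comp_mul.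
- by move=> m m' v mm'; rewrite !muln_gt0 => /andP[/(mT _ _ _ mm')-> /(mU _ _ _ mm')->].
- move=> v sv; rewrite hT // hU //; split=> [[[m hm] [m' hm']]|[m]].
    exists (maxn m m'); rewrite muln_gt0 (mT _ _ _ (leq_maxl m m')) //.
    by rewrite (mU _ _ _ (leq_maxr m m')).
  by rewrite muln_gt0 => /andP[Tm Um]; split; exists m.
Qed.

Lemma sigma1_or k P Q : sigma1 k P -> sigma1 k Q -> sigma1 k (fun v => P v \/ Q v).
Proof.
move=> [T [cT mT hT]] [U [cU mU hU]]; exists (fun v => T v + U v); split.
- exact: comp_add.
- move=> m m' v mm'; rewrite !addn_gt0 => /orP[/(mT _ _ _ mm')->//|].
  by move=> /(mU _ _ _ mm')->; rewrite orbT.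
- move=> v sv; rewrite hT // hU //; split=> [[[m hm]|[m hm]]|[m]].
  + by exists m; rewrite addn_gt0 hm.
  + by exists m; rewrite addn_gt0 hm orbT.
  + by rewrite addn_gt0 => /orP[]; [left|right]; exists m.
Qed.

(** A bounded sum or product puts its index in front of the stage, whereas [sigma1] wants the stage
    first. *)
Lemma comp_swap k T : comp k.+2 T ->
  comp k.+2 (fun v => T ([:: nth 0 v 1; nth 0 v 0] ++ drop 2 v)).
Proof.
move=> cT; apply: (@comp_args k 2 [:: fun v => nth 0 v 1; fun v => nth 0 v 0]) => //.
by move=> -[|[|//]] _; apply: comp_var.
Qed.

(** Dovetailing: stage m tests the witnesses below m, each at stage m, and the sum is positive when
    one test succeeds. *)
Lemma sigma1_ex k P : sigma1 k.+1 P -> sigma1 k (fun v => exists a, P (a :: v)).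
Proof.
move=> [T [cT mT hT]].
exists (fun v => \sum_(0 <= a < nth 0 v 0)
  T ([:: nth 0 (a :: v) 1; nth 0 (a :: v) 0] ++ drop 2 (a :: v))).
have pos m v : 0 < \sum_(0 <= a < m) T [:: m, a & v] <->
    exists2 a, a < m & 0 < T [:: m, a & v].
  rewrite big_mkord lt0n sum_nat_eq0 negb_forall; split.
    by move=> /existsP[a]; rewrite -lt0n => h; exists a.
  by case=> a am h; apply/existsP; exists (Ordinal am); rewrite -lt0n.
split.
- exact: (comp_bounded_sum (comp_swap cT) (comp_var _ _)).
- move=> m m' v mm' /=; rewrite drop0 => /pos[a am h]; apply/pos.
  by exists a; [exact: leq_trans mm'|exact: mT h].
- move=> v sv /=; rewrite drop0; split.
    case=> a /hT[|m hm]; first by rewrite /= sv.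
    exists (maxn a.+1 m); apply/pos; exists a; first by rewrite leq_maxl.
    exact: mT (leq_maxr _ _) hm.
  case=> m /pos[a am h]; exists a; apply/hT; first by rewrite /= sv.
  by exists m.
Qed.

(** By monotonicity the finitely many instances succeed at a common stage, which a product of tests
    detects. *)
Lemma sigma1_all k P B : sigma1 k.+1 P -> comp k B ->
  sigma1 k (fun v => forall a, a < B v -> P (a :: v)).
Proof.
move=> [T [cT mT hT]] cB.
exists (fun v => \prod_(0 <= a < B (drop 1 v))
  T ([:: nth 0 (a :: v) 1; nth 0 (a :: v) 0] ++ drop 2 (a :: v))).
have pos b m v : 0 < \prod_(0 <= a < b) T [:: m, a & v] <->
    forall a, a < b -> 0 < T [:: m, a & v].
  rewrite big_mkord; split; last by move=> h; apply: prodn_gt0 => i; apply: h.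
  move=> p a ab; rewrite lt0n; apply: contraTneq p => E.
  by rewrite (bigD1 (Ordinal ab)) //= E.
split.
- exact: (comp_bounded_prod (comp_swap cT) (comp_drop 1 cB)).
- move=> m m' v mm' /=; rewrite !drop0 => /pos h; apply/pos => a /h.
  exact: mT.
- move=> v sv /=; rewrite drop0; split.
    move=> h; have [m hm] : exists m, forall a, a < B v -> 0 < T [:: m, a & v].
      apply: monotone_uniform_bound => [m m' a|a /h /hT]; first exact: mT.
      by rewrite /= sv; apply.
    by exists m; apply/pos.
  case=> m /pos h a /h hm; apply/hT; first by rewrite /= sv.
  by exists m.
Qed.

Lemma sigma1_rec k m (c : recf m) (G : nat -> seq nat -> nat) :
  (forall i, i < m -> comp k (G i)) ->
  sigma1 k (fun v => exists w : m.-tuple nat, exists y,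
     tval w = [seq G i v | i <- iota 0 m] /\ rec_eval c w y).
Proof.
move=> hG; have [e [ce me he]] := normal_form_exists c.
pose H i := if i is i'.+1 then fun v => G i' (drop 1 v) else fun v => nth 0 v 0.
have HE a v : [seq H i (a :: v) | i <- iota 0 m.+1] =
    a :: [seq G i v | i <- iota 0 m].
  rewrite /= -[1]/(1 + 0) iotaDl -map_comp; congr (_ :: _).
  by apply: eq_map => i /=; rewrite drop0.
exists (fun v => e [seq H i v | i <- iota 0 m.+1]); split.
- apply: comp_subst => // -[|i] im; first exact: comp_var.
  exact/(@comp_drop k 1)/hG.
- move=> a b v ab; rewrite !HE; case E: (e _) => [//|y] _.
  by rewrite (me _ _ _ _ ab E).
- move=> v sv; split.
    case=> w [y [wE /he[a ha]]]; exists a.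
    by rewrite HE -wE ha.
  have sz : size [seq G i v | i <- iota 0 m] == m by rewrite size_map size_iota.
  case=> a; rewrite HE; case E: (e _) => [//|y] _.
  exists (Tuple sz), y; split => //; apply/he; by exists a.
Qed.

(** Minimization searches for a successful stage; the conditional inverts the test because [RMu]
    looks for a zero. *)
Lemma sigma1_domain k P : sigma1 k P ->
  exists c : recf k, forall v : k.-tuple nat, P v <-> exists y, rec_eval c v y.
Proof.
move=> [T [cT mT hT]].
have [c hc] := comp_ifz cT (comp_const _ 1) (comp_const _ 0).
exists (RMu c) => v; rewrite hT ?size_tuple //=; split.
  move=> exm; pose m := ex_minn exm; exists m; rewrite /m.
  case: ex_minnP => {}m hm minm; split.
    by have := hc [tuple of m :: v]; rewrite /=; case: (T _) hm.
  move=> i im; exists 0; have := hc [tuple of i :: v].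
  by rewrite /=; case E: (T _) => [//|z]; move: im; rewrite ltnNge minm // E.
case=> m [h _]; exists m; have := rec_eval_functional h (hc _).
by rewrite /=; case: (T _).
Qed.

End sigma1.

(** * A formula language for enumerable sets *)

Section sigma1_formulas.

Definition computable_fun2 (f : nat -> nat -> nat) : Prop :=
  exists c : recf 2, forall i j, rec_eval c [tuple i; j] (f i j).

(** The closure properties are reflected into a syntax, so that a set is enumerable as soon as it is
    written as a formula. *)
Inductive sterm : Type :=
| TVar of nat
| TCst of nat
| TAdd of sterm & sterm
| TMul of sterm & sterm
| TApp1 f of computable_fun f & sterm
| TApp2 f of computable_fun2 f & sterm & sterm.

Fixpoint term_sem (t : sterm) (v : seq nat) : nat :=
  match t with
  | TVar i => nth 0 v i
  | TCst n => n
  | TAdd t1 t2 => term_sem t1 v + term_sem t2 v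
  | TMul t1 t2 => term_sem t1 v * term_sem t2 v
  | TApp1 f _ t1 => f (term_sem t1 v)
  | TApp2 f _ t1 t2 => f (term_sem t1 v) (term_sem t2 v)
  end.

(* De Bruijn syntax: a quantifier binds variable 0; [FAll t f] is bounded by t,
   which lives outside the binder. *)
Inductive sform : Type :=
| FEq of sterm & sterm
| FRel1 A of ce_set A & sterm
| FRel2 A of ce_set2 A & sterm & sterm
| FAnd of sform & sform
| FOr of sform & sform
| FEx of sform
| FAll of sterm & sform.

Fixpoint form_sem (p : sform) (v : seq nat) : Prop :=
  match p with
  | FEq t1 t2 => term_sem t1 v = term_sem t2 v
  | FRel1 A _ t => A (term_sem t v)
  | FRel2 A _ t1 t2 => A (term_sem t1 v, term_sem t2 v)
  | FAnd p q => form_sem p v /\ form_sem q v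
  | FOr p q => form_sem p v \/ form_sem q v
  | FEx p => exists a, form_sem p (a :: v)
  | FAll t p => forall a, a < term_sem t v -> form_sem p (a :: v)
  end.

Lemma comp_term k t : comp k (term_sem t).
Proof.
elim: t => [i|n|s cs t ct|s cs t ct|f [c hc] t ct|f [c hc] s cs t ct] /=.
- exact: comp_var.
- exact: comp_const.
- exact: comp_add.
- exact: comp_mul.
- have cf : comp 1 (fun v => f (nth 0 v 0)).
    by exists c => v; case/tupleP: v => a v; rewrite tuple0; apply: hc.
  exact: comp_subst1 cf ct.
- have cf : comp 2 (fun v => f (nth 0 v 0) (nth 0 v 1)).
    exists c => v; case/tupleP: v => a v; case/tupleP: v => b v; rewrite tuple0.
    exact: hc.
  exact: comp_subst2 cf cs ct.
Qed.

Lemma sigma1_ext k P Q : (forall v, P v <-> Q v) -> sigma1 k P -> sigma1 k Q.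
Proof. by move=> PQ [T [cT mT hT]]; exists T; split=> // v sv; rewrite -PQ hT. Qed.

Lemma sigma1_form k p : sigma1 k (form_sem p).
Proof.
elim: p k => [s t|A hA t|A hA s t|p cp q cq|p cp q cq|p cp|t p cp] k /=.
- by apply: sigma1_eq; apply: comp_term.
- case: hA => c hc; have := @sigma1_rec k 1 c (fun=> term_sem t) (fun _ _ => comp_term k t).
  apply: sigma1_ext => v; rewrite hc; split.
    case=> w [y []]; case/tupleP: w => a w; rewrite tuple0 => -[-> h].
    by exists y.
  by case=> y h; exists [tuple term_sem t v], y.
- case: hA => c hc.
  have := @sigma1_rec k 2 c (fun i => term_sem (if i is 0 then s else t)).
  move=> /(_ (fun _ _ => comp_term k _)).
  apply: sigma1_ext => v; rewrite hc; split.
    case=> w [y []]; case/tupleP: w => a w; case/tupleP: w => b w.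
    by rewrite tuple0 => -[-> -> h]; exists y.
  by case=> y h; exists [tuple term_sem s v; term_sem t v], y.
- exact: sigma1_and.
- exact: sigma1_or.
- exact: sigma1_ex.
- exact: sigma1_all (comp_term k t).
Qed.

Lemma ce_form p : ce_set [set i | form_sem p [:: i]].
Proof.
have [c hc] := sigma1_domain (sigma1_form 1 p).
by exists c => i; apply: (hc [tuple i]).
Qed.

Lemma ce_form2 p : ce_set2 [set q | form_sem p [:: q.1; q.2]].
Proof.
have [c hc] := sigma1_domain (sigma1_form 2 p).
by exists c => i j; apply: (hc [tuple i; j]).
Qed.

End sigma1_formulas.

(** * Cubical cup products over F_2 *)

Section cup_product.
Import GRing.Theory.
Local Open Scope set_scope.
Local Open Scope ring_scope.

Lemma addxx_F2 (x : 'F_2) : x + x = 0.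
Proof. by case: x => -[|[|//]] ?; apply: val_inj. Qed.

Variable n : nat.

Lemma exchange_offdiag (U : zmodType) (J : {set 'I_n}) (F : 'I_n -> 'I_n -> U) :
  \sum_(j in J) \sum_(i in J :\ j) F j i = \sum_(j in J) \sum_(i in J :\ j) F i j.
Proof.
rewrite (exchange_big_dep (mem J)) /=; last by move=> i j _; rewrite !finset.inE => /andP[].
apply: eq_bigr => i iJ; apply: eq_bigl => j.
by rewrite !finset.inE iJ andbT eq_sym andbC.
Qed.

(** The terms at (i, j) and (j, i) are equal and cancel in characteristic 2. *)
Lemma sum_offdiag_sym (J : {set 'I_n}) (F : 'I_n -> 'I_n -> 'F_2) :
  (forall i j, F i j = F j i) -> \sum_(j in J) \sum_(i in J :\ j) F j i = 0.
Proof.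
move=> Fsym.
under eq_bigr => j jJ do rewrite (bigID (fun i : 'I_n => (i < j)%N)) /=.
rewrite big_split /=.
rewrite [X in _ + X](exchange_big_dep (mem J)) /=; last first.
  by move=> i j _; rewrite !finset.inE => /andP[/andP[]].
rewrite -[RHS](addxx_F2 (\sum_(j in J) \sum_(i in J :\ j | (i < j)%N) F j i)).
congr (_ + _); apply: eq_bigr => i iJ.
apply: eq_big => j; last by rewrite Fsym.
by rewrite !finset.inE iJ andbT -leqNgt andbC; case: ltngtP => //= ij;
  rewrite -?val_eqE ?(gtn_eqF ij) ?(ltn_eqF ij) //= ?ij ?eqxx ?andbF // andbC.
Qed.

Section abstract_cup.
Variables (V : zmodType) (e : 'I_n -> V).

(* The cubical cup product of the coboundaries of the functions in hs, evaluated
   on the cube with base vertex z and edge directions J. *)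
Fixpoint cup (hs : seq (V -> 'F_2)) (J : {set 'I_n}) (z : V) : 'F_2 :=
  if hs is h :: hs' then
    \sum_(j in J) (h (z + e j) + h z) * cup hs' (J :\ j) (z + e j)
  else 1.

(** A product of coboundaries is a cocycle. After one coboundary is expanded, the terms symmetric in
    the two removed directions cancel, and both sides become the double sum of [h (z + e j) * cup hs
    (J :\ j :\ i) (z + e j)]. *)
Lemma cup_cocycle hs (J : {set 'I_n}) z :
  \sum_(j in J) cup hs (J :\ j) (z + e j) = \sum_(j in J) cup hs (J :\ j) z.
Proof.
elim: hs J z => [//|h hs ih] J z /=.
have sD (i j : 'I_n) : J :\ i :\ j = J :\ j :\ i by rewrite !finset.setDDl finset.setUC.
transitivity (\sum_(j in J) \sum_(i in J :\ j) h (z + e j) * cup hs (J :\ j :\ i) (z + e j)).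
  under eq_bigr => j _.
    under eq_bigr => i _ do rewrite mulrDl.
    rewrite big_split /= -[X in _ + X]mulr_sumr ih mulr_sumr.
    over.
  rewrite big_split /= sum_offdiag_sym ?add0r// => i j.
  by rewrite sD -!addrA [e j + _]addrC.
rewrite exchange_offdiag.
under [RHS]eq_bigr => j _.
  under eq_bigr => i _ do rewrite mulrDl.
  rewrite big_split /= -[X in _ + X]mulr_sumr ih mulr_sumr.
  over.
rewrite big_split /= [X in _ = _ + X]sum_offdiag_sym => [|i j]; last by rewrite sD.
by rewrite addr0; apply: eq_bigr => j _; apply: eq_bigr => i _; rewrite sD.
Qed.

(** As [cup hs] is a cocycle, multiplying it by the coboundary of [h] gives the coboundary of [h]
    times [cup hs]; this form telescopes over a grid. *)
Lemma cup_cons_coboundary h hs (J : {set 'I_n}) z : cup (h :: hs) J z =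
  \sum_(j in J) (h (z + e j) * cup hs (J :\ j) (z + e j) + h z * cup hs (J :\ j) z).
Proof.
rewrite /= big_split /= -[X in _ = _ + X]mulr_sumr -cup_cocycle mulr_sumr -big_split.
by apply: eq_bigr => j _; rewrite mulrDl.
Qed.

End abstract_cup.

(** * Summation over a cyclic grid *)

Variable M : nat.
(** Cyclic coordinates make translation by a unit step a bijection of the grid; cubes that wrap
    around are excluded through [free_dirs]. *)
Notation V := {ffun 'I_n -> 'I_M.+2}.

Definition unit_step (j : 'I_n) : V := [ffun i => (i == j)%:R].

Lemma step_same (z : V) j : (z + unit_step j) j = z j + 1.
Proof. by rewrite !ffunE eqxx. Qed.

Lemma step_other (z : V) i j : i != j -> (z + unit_step j) i = z i.
Proof. by move=> /negbTE ij; rewrite !ffunE ij addr0. Qed.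

Definition in_cube (z : V) (J : {set 'I_n}) (w : V) : Prop :=
  forall i, w i = z i \/ (i \in J /\ w i = z i + 1).

Lemma in_cube_step (z : V) (J : {set 'I_n}) j w : j \in J ->
  in_cube (z + unit_step j) (J :\ j) w -> in_cube z J w.
Proof.
move=> jJ h i; have [ij|ij] := eqVneq i j.
  by case: (h i); rewrite ij ?step_same ?finset.inE ?eqxx; [right|case].
by case: (h i); rewrite step_other // ?finset.inE; [left|case=> /andP[_ ?] ->; right].
Qed.

Variable H : 'I_n -> V -> 'F_2.

(** The coboundary of a function constant on the vertices of a cube vanishes on its edges, and it is
    a factor of every term. *)
Lemma cup_const_eq0 ks J z k c : k \in ks ->
  (forall w, in_cube z J w -> H k w = c) -> cup unit_step (map H ks) J z = 0.
Proof.
elim: ks J z => [//|k' ks ih] J z; rewrite finset.inE => kks hc /=.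
apply: big1 => j jJ; case/predU1P: kks => [<-|kks].
  rewrite !hc ?addxx_F2 ?mul0r // => i; first by left.
  have [->|ij] := eqVneq i j; first by rewrite step_same; right.
  by rewrite step_other //; left.
by rewrite ih ?mulr0 // => w wc; apply: hc; apply: in_cube_step wc.
Qed.

(* Coordinates live in Z/(M+2), whose largest element is -1. *)
Definition free_dirs (z : V) : {set 'I_n} := [set j | z j != -1].

(** On each line in direction [j] consecutive terms cancel, leaving the ends z j = 0 and z j = -1;
    the points of the second kind are those with free directions [J :\ j]. *)
Lemma sum_telescope (J : {set 'I_n}) j (G : V -> 'F_2) : j \in J ->
  \sum_(z | free_dirs z == J) (G (z + unit_step j) + G z) =
  \sum_(z | (free_dirs z :\ j == J :\ j) && (z j == 0)) G z +
  \sum_(z | free_dirs z == J :\ j) G z.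
Proof.
move=> jJ; pose Q z := free_dirs z :\ j == J :\ j.
have QE z : (free_dirs z == J) = Q z && (z j != -1).
  apply/eqP/andP => [Ez|[/eqP Qz zj]].
    by rewrite /Q Ez eqxx; move: jJ; rewrite -Ez finset.inE.
  by rewrite -(finset.setD1K jJ) -Qz finset.setD1K // finset.inE.
have QE' z : (free_dirs z == J :\ j) = Q z && (z j == -1).
  apply/eqP/andP => [Ez|[/eqP <- zj]].
    rewrite /Q Ez finset.setDDl finset.setUid eqxx; split=> //.
    have : j \notin free_dirs z by rewrite Ez !finset.inE eqxx.
    by rewrite finset.inE negbK.
  by apply/setP => i; rewrite !finset.inE; case: (eqVneq i j) => [->|//]; rewrite zj.
have Qs z : Q (z + unit_step j) = Q z.
  rewrite /Q; congr (_ == _); apply/setP => i; rewrite !finset.inE.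
  by case: eqVneq => //= ij; rewrite step_other.
rewrite big_split /= (eq_bigl _ _ QE) (eq_bigl _ _ QE) (eq_bigl _ _ QE').
have -> : \sum_(z | Q z && (z j != -1)) G (z + unit_step j) =
    \sum_(z | Q z && (z j != 0)) G z.
  rewrite [RHS](reindex_inj (addIr (unit_step j))) /=.
  by apply: eq_bigl => z; rewrite Qs step_same addr_eq0.
have compl (a b : 'F_2) : b = a + b + a by rewrite addrAC addxx_F2 add0r.
rewrite (compl (\sum_(z | Q z && (z j == 0)) G z) (\sum_(z | Q z && (z j != 0)) G z)).
rewrite (compl (\sum_(z | Q z && (z j == -1)) G z) (\sum_(z | Q z && (z j != -1)) G z)).
rewrite -(bigID (fun z : V => z j == 0)) -(bigID (fun z : V => z j == -1)) /=.
by rewrite addrACA addxx_F2 add0r.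
Qed.

Hypothesis H_bottom : forall k (z : V), z k = 0 -> H k z = 0.
Hypothesis H_top : forall k (z : V), z k = -1 -> H k z = 1.

(** A Stokes argument moves the sum to the boundary. On the faces of a direction other than [k] a
    remaining factor comes from a constant function; on the bottom face of [k] the function [H k] is
    0. The top face, where [H k] is 1, gives the sum with one direction fewer. *)
Lemma cup_grid_sum ks : uniq ks ->
  \sum_(z | free_dirs z == [set k in ks]) cup unit_step (map H ks) [set k in ks] z = 1.
Proof.
elim: ks => [_|k ks ih]; last rewrite cons_uniq => /andP[kks uks].
  (* Without free directions the grid is the single vertex with all coordinates -1. *)
  rewrite (big_pred1 ([ffun=> -1] : V)) // => z /=.
  apply/eqP/eqP => [E|->]; last by apply/setP => j; rewrite !finset.inE ffunE eqxx.
  apply/ffunP => j; rewrite ffunE; apply/eqP.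
  have : j \notin free_dirs z by rewrite E finset.inE.
  by rewrite finset.inE negbK.
set J := [set i in k :: ks].
have JD : J :\ k = [set i in ks].
  by apply/setP => i; rewrite !finset.inE; case: eqVneq => // ->; rewrite (negbTE kks).
under eq_bigr => z _ do rewrite map_cons cup_cons_coboundary.
rewrite exchange_big /= (bigD1 k) /=; last by rewrite !finset.inE eqxx.
rewrite [X in _ + X]big1 ?addr0 => [|j /andP[jJ jk]]; last first.
  have jks : j \in ks by move: jJ; rewrite !finset.inE (negbTE jk).
  rewrite (@sum_telescope J j (fun z => H k z * cup unit_step (map H ks) (J :\ j) z)) //.
  rewrite !big1 ?addr0 // => z.
    move=> /eqP Ez; rewrite (@cup_const_eq0 _ _ _ j 1) ?mulr0 // => w /(_ j).
    have : j \notin free_dirs z by rewrite Ez !finset.inE eqxx.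
    by rewrite !finset.inE eqxx negbK => /eqP zj [|[]//]; rewrite zj => /H_top.
  move=> /andP[_ /eqP zj]; rewrite (@cup_const_eq0 _ _ _ j 0) ?mulr0 // => w /(_ j).
  by rewrite !finset.inE eqxx zj => -[/H_bottom|[]].
rewrite (@sum_telescope J k (fun z => H k z * cup unit_step (map H ks) (J :\ k) z)); last first.
  by rewrite !finset.inE eqxx.
rewrite big1 ?add0r => [|z /andP[_ /eqP /H_bottom ->]]; last by rewrite mul0r.
rewrite -[RHS]ih // JD; apply: eq_bigr => z /eqP Ez.
rewrite H_top ?mul1r //; have : k \notin free_dirs z by rewrite Ez finset.inE.
by rewrite finset.inE negbK => /eqP.
Qed.

(** Otherwise [cup_const_eq0] kills every term of a sum that equals 1. *)
Lemma nonconstant_cube : exists2 z : V, (forall k, z k != -1) &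
  forall k c, exists2 w, in_cube z finset.setT w & H k w != c.
Proof.
apply: contrapT => hn.
have ET : [set k in enum 'I_n] = finset.setT.
  by apply/setP => i; rewrite !finset.inE mem_enum.
suff S0 : \sum_(z | free_dirs z == [set k in enum 'I_n])
    cup unit_step (map H (enum 'I_n)) [set k in enum 'I_n] z = 0.
  have := cup_grid_sum (enum_uniq 'I_n); rewrite S0 => /esym E1.
  by have := oner_eq0 'F_2; rewrite E1 eqxx.
apply: big1 => z /eqP Ez; apply: contrapT => cz; apply: hn; exists z => [k|k c].
  have : k \in free_dirs z by rewrite Ez ET finset.inE.
  by rewrite finset.inE.
apply: contrapT => hw; apply: cz.
apply: (@cup_const_eq0 _ _ _ k c); first by rewrite mem_enum.
move=> w wc; apply: contrapT => /eqP Hw; apply: hw; exists w => //.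
by rewrite -ET.
Qed.

End cup_product.

(** * Separated covers of a cube *)

(** The sets whose complement in [K] satisfies [P] form a filter containing [K], proper if [P K]
    fails; since [P] holds locally, this filter has no cluster point in [K]. *)
Lemma compact_induction (T : topologicalType) (K : set T) (P : set T -> Prop) :
  compact K -> P set0 -> (forall A B, A `<=` B -> P B -> P A) ->
  (forall A B, P A -> P B -> P (A `|` B)) ->
  (forall x, K x -> exists2 U, nbhs x U & P U) -> P K.
Proof.
move=> cK P0 Psub PU Ploc; apply: contrapT => nPK.
pose F : set_system T := [set A | P (K `\` A)].
have FF : ProperFilter F.
  split; first by rewrite /F /= setD0.
  split; rewrite /F /=.
  - by rewrite setDT.
  - move=> A B PA PB; apply: Psub (PU _ _ PA PB) => z [Kz].
    by move=> /not_andP[]; [left|right].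
  - by move=> A B AB; apply: Psub => z [Kz nBz]; split => // /AB.
have [|x [Kx clx]] := cK F FF; first by rewrite /F /= setDv.
have [U Ux PUU] := Ploc x Kx.
have FU : F (~` U).
  by rewrite /F /=; apply: Psub PUU => z [_ /contrapT].
by have [z []] := clx _ _ FU Ux.
Qed.

Section cube_cover.
Import Order.TTheory GRing.Theory Num.Theory.
Local Open Scope ring_scope.
Variables (R : realType) (n : nat).
Implicit Types x y z a : 'rV[R]_n.

Lemma rV_ballP x y (e : R) : 0 < e ->
  ball x e y <-> forall k, `|x 0 k - y 0 k| < e.
Proof.
move=> e0; split=> [[_ h] k|h]; first exact: (h 0 k).
by split=> // i k; rewrite (ord1 i); apply: h.
Qed.

Lemma compact_box (lo hi : 'I_n -> R) :
  compact [set z : 'rV[R]_n | forall k, lo k <= z 0 k <= hi k].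
Proof.
have := rV_compact (fun k => @segment_compact R (lo k) (hi k)).
congr compact; apply/seteqP; split=> z h k; have := h k; by rewrite /= in_itv.
Qed.

Lemma lebesgue_number (J : Type) (U : J -> set 'rV[R]_n) (K : set 'rV[R]_n) :
  compact K -> (forall j, open (U j)) -> (forall z, K z -> exists j, U j z) ->
  exists2 d : R, 0 < d & forall z, K z -> exists j, ball z d `<=` U j.
Proof.
move=> cK oU KU.
apply: (@compact_induction _ K (fun A => exists2 d : R, 0 < d &
  forall z, A z -> exists j, ball z d `<=` U j)) => //.
- by exists 1.
- by move=> A B AB [d d0 hd]; exists d => // z /AB; apply: hd.
- move=> A B [d d0 hd] [d' d0' hd']; exists (Num.min d d').
    by rewrite lt_min d0.
  move=> z [/hd|/hd'] [j zj]; exists j; apply: subset_trans zj;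
    by apply: le_ball; rewrite ge_min lexx ?orbT.
- move=> x /KU[j Ux].
  have /nbhs_ballP[d /= d0 hd] := open_nbhs_nbhs (conj (oU j) Ux).
  exists (ball x (d / 2)); first by apply: nbhsx_ballx; rewrite divr_gt0.
  exists (d / 2); first by rewrite divr_gt0.
  move=> z xz; exists j => w zw; apply: hd.
  by rewrite [d]splitr; apply: ball_triangle xz zw.
Qed.

(* Discretise h_k = indicator of (U k true or the top face): the cubical cup
   product of the coboundaries of the h_k sums to 1 over the grid, so some grid
   cube lies in no single U k s. *)
Lemma cube_not_covered a (l : R) (U : 'I_n -> bool -> set 'rV[R]_n) :
  0 < l -> (forall k s, open (U k s)) ->
  (forall k z, U k false z -> ~ U k true z) ->
  let K : set 'rV[R]_n := [set z | forall k, a 0 k <= z 0 k <= a 0 k + l] in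
  (forall k z, K z -> z 0 k = a 0 k -> ~ U k true z) ->
  (forall k z, K z -> z 0 k = a 0 k + l -> ~ U k false z) ->
  exists2 z, K z & forall k s, ~ U k s z.
Proof.
move=> l0 oU dU K bot top; apply: contrapT => ncov.
have [d d0 hd] : exists2 d : R, 0 < d &
    forall z, K z -> exists ks : 'I_n * bool, ball z d `<=` U ks.1 ks.2.
  apply: (lebesgue_number (U := fun ks => U ks.1 ks.2)) => //.
    exact: compact_box.
  move=> z Kz; apply: contrapT => h; apply: ncov; exists z => // k s Uz.
  by apply: h; exists (k, s).
(* The grid has M + 1 steps along each edge, which makes its mesh smaller than the Lebesgue number
   [d]. *)
pose M := Num.truncn (l / d).
have Md : l / M.+1%:R < d.
  rewrite ltr_pdivrMr // mulrC -ltr_pdivrMr //.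
  exact: truncnS_gt.
pose V := {ffun 'I_n -> 'I_M.+2}.
pose pt (z : V) : 'rV[R]_n := \row_k (a 0 k + l * ((z k : nat)%:R / M.+1%:R)).
have ptK (z : V) : K (pt z).
  move=> k; rewrite mxE lerDl lerD2l; apply/andP; split.
    by rewrite mulr_ge0 ?(ltW l0) // divr_ge0.
  rewrite ger_pMr // ler_pdivrMr // mul1r ler_nat.
  by have := ltn_ord (z k).
pose H k (z : V) : 'F_2 := if (z k == -1) || `[< U k true (pt z) >] then 1 else 0.
have top_val (i : 'I_M.+2) : i = -1 -> (i : nat) = M.+1.
  by move=> -> /=; rewrite modn_small //; lia.
have Hb k (z : V) : z k = 0 -> H k z = 0.
  move=> zk; rewrite /H zk; case: eqP => [/top_val//|_] /=.
  case: asboolP => // /bot; case=> //; rewrite mxE zk /= mul0r mulr0 addr0 //.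
have Ht k (z : V) : z k = -1 -> H k z = 1 by move=> zk; rewrite /H zk eqxx.
have [z znt hz] := nonconstant_cube Hb Ht.
have [[k s] /= ks] := hd _ (ptK z).
(* All vertices of the cube at [z] are within [d] of [pt z], hence in [U k s]; this forces [H k] to
   be constantly [s] on them. *)
have [w wz /eqP[]] := hz k s%:R.
have Uw : U k s (pt w).
  apply: ks; apply/rV_ballP => // i; rewrite !mxE.
  have [->|[_ ->]] := wz i; first by rewrite subrr normr0.
  have zi : (z i < M.+1)%N.
    rewrite ltn_neqAle -ltnS ltn_ord andbT; apply: contra (znt i) => /eqP zi.
    by apply/eqP/val_inj; rewrite /= zi modn_small //; lia.
  have -> : nat_of_ord (z i + 1) = (z i).+1.
    by rewrite /= (@modn_small 1) // modn_small addn1.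
  rewrite opprD addrACA subrr add0r -mulrBr -mulrBl -natr1 opprD addrA subrr add0r.
  by rewrite mulN1r mulrN normrN gtr0_norm // divr_gt0.
rewrite /H; case: s ks Uw => ks Uw.
  by case: asboolP => //; rewrite orbT.
case: asboolP => [/(dU _ _ Uw)//|_]; rewrite orbF; case: eqP => // /top_val wk.
case: (top k (pt w)) => //; rewrite mxE wk divff ?mulr1 //.
Qed.
End cube_cover.

(** * Formal disjointness *)

(** This pairing is a polynomial, hence a term of the formula language. It is injective because t <=
    t + s is less than the gap from the square of t + s to the next square. *)
Definition sqpair (t s : nat) : nat := (t + s) * (t + s) + t.

Lemma sqpair_inj t s t' s' : sqpair t s = sqpair t' s' -> t = t' /\ s = s'.
Proof.
rewrite /sqpair => h.
have E : t + s = t' + s'.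
  have [lt|lt|//] := ltngtP (t + s) (t' + s'); exfalso.
    by have := leq_mul lt lt; lia.
  by have := leq_mul lt lt; lia.
by rewrite E in h; lia.
Qed.

Lemma leq_sqpairl t s : t <= sqpair t s.
Proof. by rewrite /sqpair leq_addl. Qed.

Lemma leq_sqpairr t s : s <= sqpair t s.
Proof. by rewrite /sqpair; nia. Qed.

Definition TPair t s := TAdd (TMul (TAdd t s) (TAdd t s)) t.

Section finite_set_formulas.
Variables (fs : nat -> set nat) (hfs : cfv_enumeration fs).

Definition fs_char (j i : nat) : nat := `[< fs j i >].

Lemma computable_fs_char : computable_fun2 fs_char.
Proof. by case: hfs => -[c hc] _ _; exists c => j i; apply: hc. Qed.

Definition FIn t s := FEq (TApp2 computable_fs_char t s) (TCst 1).
Definition FNotIn t s := FEq (TApp2 computable_fs_char t s) (TCst 0).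

Lemma fs_char1 j i : fs_char j i = 1 <-> fs j i.
Proof. by rewrite /fs_char; case: asboolP. Qed.

Lemma fs_char0 j i : fs_char j i = 0 <-> ~ fs j i.
Proof. by rewrite /fs_char; case: asboolP. Qed.

Lemma fs_onto (A : set nat) : finite_set A -> A !=set0 -> exists j, fs j = A.
Proof.
move=> fA A0; have [_ _ E] := hfs.
have : [set A | finite_set A /\ A !=set0] A by [].
by rewrite -E => -[j _ <-]; exists j.
Qed.

(** Repeated refinement of covers produces chains of formal inclusions, hence the reflexive
    transitive closure. *)
Inductive clos (C : set (nat * nat)) : nat -> nat -> Prop :=
| clos_refl i : clos C i i
| clos_step k k' i : C (k, k') -> clos C k' i -> clos C k i.

Lemma clos_trans C a b c : clos C a b -> clos C b c -> clos C a c.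
Proof. by elim=> // k k' i Ck _ ih /ih; apply: clos_step. Qed.

Lemma clos1 (C : set (nat * nat)) a b : C (a, b) -> clos C a b.
Proof. by move=> h; apply: clos_step h (clos_refl _ _). Qed.

(* A chain k = s_t, ..., s_0 = i is recorded as a finite set of codes of pairs
   (rank, element). *)
Lemma ce_clos (C : set (nat * nat)) : ce_set2 C -> ce_set2 [set p | clos C p.1 p.2].
Proof.
move=> hC; have [_ [phi hphi phiP] _] := hfs.
(* Elements of [fs j] are at most [phi j], whereas [FAll] is strict; both components of a pair are
   bounded by its code. *)
pose bound j := TAdd (TApp1 hphi j) (TCst 1).
pose chain := FEx (FAnd
  (FEx (FIn (TVar 1) (TPair (TVar 0) (TVar 2))))
  (FAll (bound (TVar 0)) (FAll (bound (TVar 1))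
    (FOr (FNotIn (TVar 2) (TPair (TVar 1) (TVar 0)))
    (FOr (FAnd (FEq (TVar 1) (TCst 0)) (FEq (TVar 0) (TVar 4)))
    (FEx (FEx (FAnd (FEq (TVar 3) (TAdd (TVar 0) (TCst 1)))
      (FAnd (FIn (TVar 4) (TPair (TVar 0) (TVar 1)))
            (FRel2 hC (TVar 2) (TVar 1))))))))))).
suff -> : [set p | clos C p.1 p.2] = [set p | form_sem chain [:: p.1; p.2]].
  exact: ce_form2.
apply/seteqP; split=> -[k i] /=; last first.
  case=> j [[t /fs_char1 jt] hj].
  (* The rank drops at each link, so induction on it recovers the chain from the finite set. *)
  have rank t' s : fs j (sqpair t' s) -> clos C s i.
    elim: t' s => [|t' ih] s js.
      case: (hj 0 _ s) => [| |/fs_char0//|[[_ ->]|[s' [t0 [/eqP]]]]].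
      - by rewrite addn1.
      - by have := phiP _ _ js; have := leq_sqpairr 0 s; lia.
      - exact: clos_refl.
      - by rewrite addn1.
    case: (hj t'.+1 _ s) => [| |/fs_char0//|[[]//|[s' [t0 [/eqP]]]]].
    - by have := phiP _ _ js; have := leq_sqpairl t'.+1 s; lia.
    - by have := phiP _ _ js; have := leq_sqpairr t'.+1 s; lia.
    - rewrite addn1 => /eqP[<-] [/fs_char1 js' Cs].
      exact: clos_step Cs (ih _ js').
  exact: rank jt.
move=> h; suff [j [[t jt] hj]] : exists j, (exists t, fs j (sqpair t k)) /\
    forall t s, fs j (sqpair t s) -> (t = 0 /\ s = i) \/
      exists s' t', [/\ t = t' + 1, fs j (sqpair t' s') & C (s, s')].
  exists j; split; first by exists t; apply/fs_char1.
  move=> t' _ s _; case: (pselect (fs j (sqpair t' s))) => [/hj|]; last first.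
    by left; apply/fs_char0.
  move=> h'; right; case: h' => [|[s' [t0 [-> js' Cs]]]]; [by left|right].
  by exists s', t0; split=> //; split=> //; apply/fs_char1.
elim: h => {k i} [i|k k' i Ck _ [j [[t jt] hj]]].
  have [j jE] : exists j, fs j = [set sqpair 0 i].
    by apply: fs_onto; [exact: finite_set1|exists (sqpair 0 i)].
  exists j; rewrite jE; split; first by exists 0.
  by move=> t s /= /sqpair_inj[-> ->]; left.
have fj : finite_set (fs j).
  have [_ _ E] := hfs; have : range fs (fs j) by exists j.
  by rewrite E => -[].
have [j' jE] : exists j', fs j' = fs j `|` [set sqpair t.+1 k].
  by apply: fs_onto; [rewrite finite_setU; split|exists (sqpair t.+1 k); right].
exists j'; rewrite jE; split; first by exists t.+1; right.
move=> t' s [/hj[|[s' [t0 [-> js' Cs]]]]|/= /sqpair_inj[-> ->]].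
- by left.
- by right; exists s', t0; split=> //; left.
- by right; exists k', t; rewrite addn1; split=> //; left.
Qed.

(** This enlargement of [D] is inherited by formally smaller basic sets, so it survives refinement
    of covers, and it is still enumerable. *)
Definition formally_disjoint (C D : set (nat * nat)) (a b : nat) : Prop :=
  exists a' b', [/\ clos C a a', clos C b b' & D (a', b')].

Lemma ce_formally_disjoint C D : ce_set2 C -> ce_set2 D ->
  ce_set2 [set p | formally_disjoint C D p.1 p.2].
Proof.
move=> /ce_clos hC hD.
pose p := FEx (FEx (FAnd (FRel2 hC (TVar 2) (TVar 1))
  (FAnd (FRel2 hC (TVar 3) (TVar 0)) (FRel2 hD (TVar 1) (TVar 0))))).
suff -> : [set p | formally_disjoint C D p.1 p.2] = [set q | form_sem p [:: q.1; q.2]].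
  exact: ce_form2.
apply/seteqP; split=> -[a b] /=.
  by case=> a' [b' [ha hb hd]]; exists a', b'.
by case=> a' [b' [ha [hb hd]]]; exists a', b'.
Qed.

Lemma formally_disjoint_clos C D a a' b b' : clos C a a' -> clos C b b' ->
  formally_disjoint C D a' b' -> formally_disjoint C D a b.
Proof.
move=> ha hb [a0 [b0 [ha0 hb0 hd]]]; exists a0, b0.
by split=> //; [exact: clos_trans ha0|exact: clos_trans hb0].
Qed.

(* The dummy code of (m, 0) is there because [fs] enumerates nonempty sets only. *)
Lemma fs_code_family (L : nat -> seq nat) m :
  exists j, forall k a, fs j (sqpair k a) <-> (k < m /\ a \in L k) \/ (k = m /\ a = 0).
Proof.
pose cs := sqpair m 0 :: [seq sqpair k a | k <- iota 0 m, a <- L k].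
have [j jE] : exists j, fs j = [set` cs].
  by apply: fs_onto => //; exists (sqpair m 0); rewrite /= mem_head.
exists j => k a; rewrite jE /= inE; split.
  move=> /predU1P[/sqpair_inj[-> ->]|]; first by right.
  move=> /allpairsPdep[k' [a' [km aL /sqpair_inj[-> ->]]]]; left.
  by split=> //; rewrite mem_iota in km.
case=> [[km aL]|[-> ->]]; last by rewrite eqxx.
apply/orP; right; apply/allpairsPdep; exists k, a; split=> //.
by rewrite mem_iota.
Qed.

Lemma fs_code_ord_family n (L : 'I_n -> seq nat) :
  exists j, forall (k : 'I_n) a, fs j (sqpair k a) <-> a \in L k.
Proof.
have [j hj] := fs_code_family (fun k => if insub k is Some k' then L k' else [::]) n.
exists j => k a; rewrite hj valK; split=> [[[]//|[kn]]|aL]; last by left.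
by have := ltn_ord k; rewrite kn ltnn.
Qed.

(* A certificate that I_i meets S: fs q lists a cover of S by basic sets, the
   codes in j0 and j1 assign some of them to the lower, resp. upper, side of
   coordinate k, and b0, b1 code covers of the upper, resp. lower, k-th face. *)
Lemma ce_certificate (A : set nat) (E : set (nat * nat)) n w b0 b1 :
  ce_set A -> ce_set2 E ->
  ce_set [set i | exists q j0 j1, [/\ A q,
    forall a, fs q a -> [\/ a = i, fs w (sqpair 0 a) |
      exists k, k < n /\ (fs j0 (sqpair k a) \/ fs j1 (sqpair k a))],
    forall k a, k < n -> fs j0 (sqpair k a) ->
      (forall b, fs b0 (sqpair k b) -> E (a, b)) /\
      (forall b, fs j1 (sqpair k b) -> E (a, b)) &
    forall k a, k < n -> fs j1 (sqpair k a) ->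
      forall b, fs b1 (sqpair k b) -> E (a, b)]].
Proof.
move=> hA hE; have [_ [phi hphi phiP] _] := hfs.
pose bound j := TAdd (TApp1 hphi j) (TCst 1).
(* As [a <= F a], the bound on elements of [fs j] also bounds [a], so quantification over members is
   bounded. *)
have allP (F : nat -> nat) j (P : nat -> Prop) : (forall a, a <= F a) ->
    (forall a, a < phi j + 1 -> fs_char j (F a) = 0 \/ P a) <->
    (forall a, fs j (F a) -> P a).
  move=> leF; split=> [h a ja|h a _].
    have aphi : a < phi j + 1 by have := phiP _ _ ja; have := leF a; lia.
    by case: (h a aphi) => // /fs_char0.
  by case: (pselect (fs j (F a))) => [/h|/fs_char0]; [right|left].
have sq k a : a <= sqpair k a := leq_sqpairr k a.
pose p := FEx (FEx (FEx (FAnd (FRel1 hA (TVar 2)) (FAnd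
  (FAll (bound (TVar 2)) (FOr (FNotIn (TVar 3) (TVar 0))
    (FOr (FEq (TVar 0) (TVar 4)) (FOr (FIn (TCst w) (TPair (TCst 0) (TVar 0)))
      (* The inner existential, k + m + 1 = n, expresses k < n. *)
      (FEx (FAnd (FEx (FEq (TAdd (TAdd (TVar 1) (TVar 0)) (TCst 1)) (TCst n)))
        (FOr (FIn (TVar 3) (TPair (TVar 0) (TVar 1)))
             (FIn (TVar 2) (TPair (TVar 0) (TVar 1))))))))))
  (FAnd
  (FAll (TCst n) (FAll (bound (TVar 2)) (FOr
    (FNotIn (TVar 3) (TPair (TVar 1) (TVar 0)))
    (FAnd
      (FAll (bound (TCst b0)) (FOr (FNotIn (TCst b0) (TPair (TVar 2) (TVar 0)))
        (FRel2 hE (TVar 1) (TVar 0))))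
      (FAll (bound (TVar 2)) (FOr (FNotIn (TVar 3) (TPair (TVar 2) (TVar 0)))
        (FRel2 hE (TVar 1) (TVar 0))))))))
  (FAll (TCst n) (FAll (bound (TVar 1)) (FOr
    (FNotIn (TVar 2) (TPair (TVar 1) (TVar 0)))
      (FAll (bound (TCst b1)) (FOr (FNotIn (TCst b1) (TPair (TVar 2) (TVar 0)))
        (FRel2 hE (TVar 1) (TVar 0)))))))))))).
have := ce_form p; congr ce_set; apply/seteqP; split=> i /=.
- case=> q [j0 [j1 [Aq [hq [h0 h1]]]]]; exists q, j0, j1; split=> //.
  + move=> a qa; have := (allP id q _ (leqnn)).1 hq a qa.
    case=> [->|[/fs_char1 aw|[k [[m <-] h]]]]; [exact: Or31|exact: Or32|apply: Or33].
    exists k; split; first by lia.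
    by case: h => /fs_char1; [left|right].
  + move=> k a kn ja; have [hb hj] := (allP (sqpair k) j0 _ (sq k)).1 (h0 k kn) a ja.
    by split; [exact: (allP (sqpair k) b0 _ (sq k)).1 hb|exact: (allP (sqpair k) j1 _ (sq k)).1 hj].
  + move=> k a kn ja; have hb := (allP (sqpair k) j1 _ (sq k)).1 (h1 k kn) a ja.
    exact: (allP (sqpair k) b1 _ (sq k)).1 hb.
- case=> q [j0 [j1 [Aq hq h0 h1]]]; exists q, j0, j1; split=> //; split; last split.
  + apply: (allP id q _ (leqnn)).2 => a /hq[->|aw|[k [kn h]]]; [by left|right; left; exact/fs_char1|].
    right; right; exists k; split; first by exists (n - k.+1); lia.
    by case: h => /fs_char1; [left|right].
  + move=> k kn; apply: (allP (sqpair k) j0 _ (sq k)).2 => a /(h0 _ _ kn)[hb hj].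
    by split; [exact: (allP (sqpair k) b0 _ (sq k)).2 hb|exact: (allP (sqpair k) j1 _ (sq k)).2 hj].
  + move=> k kn; apply: (allP (sqpair k) j1 _ (sq k)).2 => a /(h1 _ _ kn) hb.
    exact: (allP (sqpair k) b1 _ (sq k)).2 hb.
Qed.

End finite_set_formulas.

(** * Formally disjoint finite covers of compact sets *)

Section formal_separation.
Variables (X : topologicalType) (I : nat -> set X) (C D : set (nat * nat)).
Hypothesis I_basis : basis (range I).
Hypothesis D_disj : forall i j, D (i, j) -> I i `&` I j = set0.
Hypothesis C_sub : forall i j, C (i, j) -> I i `<=` I j.
Hypothesis D_sep : forall x y, x <> y -> exists i j, [/\ I i x, I j y & D (i, j)].
Hypothesis C_meet : forall i j x, (I i `&` I j) x ->
  exists k, [/\ I k x, C (k, i) & C (k, j)].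
Implicit Types (K L : set X) (u v w : seq nat).

Lemma basis_open i : open (I i).
Proof. by have [h _] := I_basis; apply: h; exists i. Qed.

Lemma basis_nbhs i x : I i x -> nbhs x (I i).
Proof. by move=> h; apply: open_nbhs_nbhs; split=> //; apply: basis_open. Qed.

Lemma basis_cover x : exists i, I i x.
Proof.
have [_ h] := I_basis; have [_ [[i _ <-] ix] _] := h x setT filterT.
by exists i.
Qed.

Lemma clos_sub a b : clos C a b -> I a `<=` I b.
Proof.
elim=> [i|k k' i /C_sub Ck _]; first exact: subset_refl.
exact: subset_trans Ck.
Qed.

Lemma formally_disjointP a b x : formally_disjoint C D a b -> I a x -> ~ I b x.
Proof.
case=> a' [b' [/clos_sub ha /clos_sub hb /D_disj E]] /ha xa /hb xb.
by have : (I a' `&` I b') x by []; rewrite E.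
Qed.

Definition union_of u : set X := [set x | exists2 a, a \in u & I a x].

Lemma union_of_cat u v : union_of u `|` union_of v `<=` union_of (u ++ v).
Proof.
by move=> x [] [a au Ia]; exists a => //; rewrite mem_cat au ?orbT.
Qed.

Lemma compact_union_of K : compact K -> exists u, K `<=` union_of u.
Proof.
move=> cK; apply: (compact_induction (P := fun A => exists u, A `<=` union_of u) cK).
- by exists [::].
- by move=> A B AB [u Bu]; exists u; apply: subset_trans Bu.
- move=> A B [u Au] [v Bv]; exists (u ++ v).
  by apply: subset_trans (@union_of_cat u v); apply: setUSS.
- move=> x _; have [i ix] := basis_cover x; exists (I i); first exact: basis_nbhs.
  by exists [:: i] => y Iy; exists i; rewrite ?mem_head.
Qed.

(** A point in a member of [u] and a member of [v] has, by [C_meet], a basic neighborhood formally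
    inside both; compactness leaves finitely many of these. *)
Lemma compact_refine K u v : compact K -> K `<=` union_of u -> K `<=` union_of v ->
  exists2 w, K `<=` union_of w & forall a, a \in w ->
    (exists2 b, b \in u & clos C a b) /\ (exists2 b, b \in v & clos C a b).
Proof.
move=> cK Ku Kv; pose ok w := forall a, a \in w ->
    (exists2 b, b \in u & clos C a b) /\ (exists2 b, b \in v & clos C a b).
apply: (compact_induction (P := fun A => exists2 w, A `<=` union_of w & ok w) cK).
- by exists [::].
- by move=> A B AB [w Bw okw]; exists w => //; apply: subset_trans Bw.
- move=> A B [w Aw okw] [w' Bw' okw']; exists (w ++ w').
    by apply: subset_trans (@union_of_cat w w'); apply: setUSS.
  by move=> a; rewrite mem_cat => /orP[/okw|/okw'].
- move=> x Kx; have [a au ax] := Ku x Kx; have [b bv bx] := Kv x Kx.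
  have [k [kx ka kb]] := C_meet (conj ax bx).
  exists (I k); first exact: basis_nbhs.
  exists [:: k] => [y ky|c]; first by exists k; rewrite ?mem_head.
  by rewrite inE => /eqP ->; split; [exists a|exists b] => //; apply: clos1.
Qed.

(** The argument for disjoint compact sets in a Hausdorff space, first for a point against [L], then
    for [K] against [L]. Merging two pieces takes [C_meet] at the point, respectively a common
    refinement of the two covers of [L]. *)
Lemma compact_formal_separation K L : compact K -> compact L ->
  (forall x, K x -> ~ L x) ->
  exists u v, [/\ K `<=` union_of u, L `<=` union_of v &
    forall a b, a \in u -> b \in v -> formally_disjoint C D a b].
Proof.
move=> cK cL KL.
have point x : K x -> exists i v, [/\ I i x, L `<=` union_of v &
    forall b, b \in v -> formally_disjoint C D i b].
  move=> Kx; apply: (compact_induction (P := fun A => exists i v,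
    [/\ I i x, A `<=` union_of v & forall b, b \in v -> formally_disjoint C D i b]) cL).
  - by have [i ix] := basis_cover x; exists i, [::]; split=> // y.
  - move=> A B AB [i [v [ix Bv h]]]; exists i, v; split=> //.
    exact: subset_trans Bv.
  - move=> A B [i [v [ix Av h]]] [i' [v' [ix' Bv' h']]].
    have [k [kx ki ki']] := C_meet (conj ix ix').
    exists k, (v ++ v'); split=> //.
      by apply: subset_trans (@union_of_cat v v'); apply: setUSS.
    move=> b; rewrite mem_cat => /orP[/h|/h'] fd;
      by apply: formally_disjoint_clos fd; [exact: clos1|exact: clos_refl].
  - move=> y Ly; have xy : x <> y by move=> E; apply: KL Kx _; rewrite E.
    have [i [j [ix jy Dij]]] := D_sep xy.
    exists (I j); first exact: basis_nbhs.
    exists i, [:: j]; split=> // [z jz|b]; first by exists j; rewrite ?mem_head.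
    by rewrite inE => /eqP ->; exists i, j; split=> //; apply: clos_refl.
apply: (compact_induction (P := fun A => exists u v, [/\ A `<=` union_of u,
  L `<=` union_of v &
  forall a b, a \in u -> b \in v -> formally_disjoint C D a b]) cK).
- by have [v Lv] := compact_union_of cL; exists [::], v; split=> // y.
- move=> A B AB [u [v [Bu Lv h]]]; exists u, v; split=> //.
  exact: subset_trans Bu.
- move=> A B [u [v [Au Lv h]]] [u' [v' [Bu' Lv' h']]].
  have [w Lw hw] := compact_refine cL Lv Lv'.
  exists (u ++ u'), w; split=> //.
    by apply: subset_trans (@union_of_cat u u'); apply: setUSS.
  move=> a b + /hw[[c cv bc] [c' cv' bc']]; rewrite mem_cat => /orP[au|au'].
    exact: formally_disjoint_clos (clos_refl _ _) bc (h _ _ au cv).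
  exact: formally_disjoint_clos (clos_refl _ _) bc' (h' _ _ au' cv').
- move=> x /point[i [v [ix Lv h]]]; exists (I i); first exact: basis_nbhs.
  exists [:: i], v; split=> // [y iy|a b]; first by exists i; rewrite ?mem_head.
  by rewrite inE => /eqP -> /h.
Qed.

End formal_separation.

(** * Covers in a Euclidean chart *)

(** The image of [U] is its preimage under [f], so it is open in [N]; intersecting with [V], whose
    trace on [S] lies in [N], turns this into a trace on [S]. *)
Lemma chart_image_open (X Y : topologicalType) (S N V : set X) (f : X -> Y)
    (g : Y -> X) (U : set Y) :
  {within N, continuous f} -> (forall y, N (g y)) ->
  (forall a, N a -> g (f a) = a) -> cancel g f ->
  open V -> V `&` S `<=` N -> open U -> g @` U `<=` V ->
  exists2 O, open O & forall a, S a -> (O a <-> (g @` U) a).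
Proof.
move=> cf gN gf fg oV VSN oU UV.
have /open_subspaceP[W oW WE] := (continuousP _).1 cf U oU.
exists (W `&` V); first exact: openI.
move=> a Sa; split=> [[Wa Va]|[y Uy <-]].
  have Na := VSN a (conj Va Sa); exists (f a); last exact: gf.
  by have : (W `&` N) a by []; rewrite WE => -[].
split; last by apply: UV; exists y.
suff : (W `&` N) (g y) by case.
by rewrite WE; split=> //; rewrite /preimage /= /from_subspace fg.
Qed.

Section cube_chart.
Import Order.TTheory GRing.Theory Num.Theory.
Local Open Scope ring_scope.
Variables (R : realType) (n : nat) (c : 'rV[R]_n) (r : R).

Definition signed (s : bool) (t : R) : R := if s then t else - t.

Lemma signedN s t : signed (~~ s) t = - signed s t.
Proof. by case: s; rewrite /= ?opprK. Qed.

Definition closed_cube (t : R) : set 'rV[R]_n := [set z | forall k, `|c 0 k - z 0 k| <= t].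

(** The level [t] may be negative: at - r the two sides overlap in a slab around the centre. *)
Definition half_cube (k : 'I_n) (s : bool) (t : R) : set 'rV[R]_n :=
  [set z | closed_cube (3 * r) z /\ t <= signed s (z 0 k - c 0 k)].

Lemma closed_cubeE t : closed_cube t =
  [set z | forall k, c 0 k - t <= z 0 k <= c 0 k - t + 2 * t].
Proof.
apply/seteqP; split=> z h k; have := h k; rewrite /= ler_norml.
  by move=> /andP[h1 h2]; apply/andP; split; lra.
by move=> /andP[h1 h2]; apply/andP; split; lra.
Qed.

Lemma compact_closed_cube t : compact (closed_cube t).
Proof. by rewrite closed_cubeE; apply: compact_box. Qed.

Lemma compact_half_cube k s t : compact (half_cube k s t).
Proof.
pose lo (i : 'I_n) : R := if (i == k) && s then Num.max (c 0 i - 3 * r) (c 0 i + t) else c 0 i - 3 * r.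
pose hi (i : 'I_n) : R := if (i == k) && ~~ s then Num.min (c 0 i + 3 * r) (c 0 i - t) else c 0 i + 3 * r.
have E (z : 'rV[R]_n) i : (lo i <= z 0 i <= hi i) =
    (`|c 0 i - z 0 i| <= 3 * r) && ((i != k) || (t <= signed s (z 0 i - c 0 i))).
  rewrite /lo /hi ler_norml; case: s {lo hi}; case: (i == k);
    rewrite /= ?ge_max ?le_min; apply/idP/idP; lra.
have := @compact_box R n lo hi; congr compact; apply/seteqP; split=> z /=.
  move=> h; split=> [i|]; first by have := h i; rewrite E => /andP[].
  by have := h k; rewrite E eqxx => /andP[].
case=> cz h i; rewrite E cz /=; case: eqP => //= ->.
exact: h.
Qed.

Lemma half_cube_disjoint k s t t' z : 0 < t + t' ->
  half_cube k s t z -> ~ half_cube k (~~ s) t' z.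
Proof. by move=> tt' [_ h] [_]; rewrite signedN => h'; lra. Qed.

Lemma half_cubeW k s t t' : t' <= t -> half_cube k s t `<=` half_cube k s t'.
Proof. by move=> tt' z [cz h]; split=> //; apply: le_trans h. Qed.

(** For the sup norm, leaving the ball means differing from [y] by at least [e], upwards or
    downwards, in some coordinate. *)
Lemma half_cube_cover y e z : closed_cube (3 * r) z -> 0 < e -> ~ ball y e z ->
  exists k s, half_cube k s (signed s (y 0 k - c 0 k) + e) z.
Proof.
move=> cz e0 nb; apply: contrapT => h; apply: nb; apply/rV_ballP => // k.
rewrite ltr_norml; apply/andP; split; apply: contrapT => /negP; rewrite -leNgt => le.
  by apply: h; exists k, true; split=> //=; lra.
by apply: h; exists k, false; split=> //=; lra.
Qed.

End cube_chart.

(** * Soundness and completeness of certificates *)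

Section chart_certificate.
Import Order.TTheory GRing.Theory Num.Theory.
Local Open Scope ring_scope.
Variables (R : realType) (fs : nat -> set nat).
Variables (X : topologicalType) (I : nat -> set X) (C D : set (nat * nat)).
Hypothesis I_basis : basis (range I).
Hypothesis D_disj : forall i j, D (i, j) -> I i `&` I j = set0.
Hypothesis C_sub : forall i j, C (i, j) -> I i `<=` I j.
Hypothesis D_sep : forall x y, x <> y -> exists i j, [/\ I i x, I j y & D (i, j)].
Hypothesis C_meet : forall i j x, (I i `&` I j) x ->
  exists k, [/\ I k x, C (k, i) & C (k, j)].
Variables (S O : set X) (n : nat) (g : 'rV[R]_n -> X) (c : 'rV[R]_n) (r : R).
Hypothesis contg : continuous g.
Hypotheses (injg : injective g) (gS : forall z, S (g z)) (r_gt0 : 0 < r).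
Hypothesis OE : forall a, S a -> (O a <-> (g @` ball c (3 * r)) a).

Let half k s t := g @` half_cube c r k s t.

Let compact_half k s t : compact (half k s t).
Proof.
apply: continuous_compact; first exact: continuous_subspaceT.
exact: compact_half_cube.
Qed.

Let half_disjoint k s t t' x : 0 < t + t' -> half k s t x -> ~ half k (~~ s) t' x.
Proof.
move=> tt' [z hz <-] [z' hz' /injg zz']; rewrite zz' in hz'.
exact: half_cube_disjoint hz hz'.
Qed.

(** The face covers [be] must not depend on the basic set under test, whereas the separating covers
    do. Refining the latter into the fixed covers [mu] makes them formally disjoint from [be]. *)
Variables (w w' : seq nat) (be mu : 'I_n -> bool -> seq nat).
Hypothesis wS : S `&` ~` O `<=` union_of I w.
Hypothesis w'c : g @` closed_cube c (2 * r) `<=` union_of I w'.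
Hypothesis ww' : forall a b, a \in w -> b \in w' -> formally_disjoint C D a b.
Hypothesis muP : forall k s, half k s (- r) `<=` union_of I (mu k s).
Hypothesis beP : forall k s, half k (~~ s) (2 * r) `<=` union_of I (be k s).
Hypothesis mube : forall k s a b, a \in mu k s -> b \in be k s ->
  formally_disjoint C D a b.

(** No point of the middle cube is covered by [w], which is formally disjoint from [w']. If [I i]
    missed [S], the sets [U k s] would cover this cube, contrary to [cube_not_covered]. *)
Lemma certificate_sound i q (F : 'I_n -> bool -> set nat) :
  S `<=` finite_union I fs q ->
  (forall a, fs q a -> [\/ a = i, a \in w | exists k s, F k s a]) ->
  (forall k a b, F k false a -> F k true b -> formally_disjoint C D a b) ->
  (forall k s a b, F k s a -> b \in be k s -> formally_disjoint C D a b) ->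
  I i `&` S !=set0.
Proof.
move=> Sq hq F01 Fbe; apply: contrapT => nIS.
pose U k s : set 'rV[R]_n := g @^-1` (\bigcup_(a in F k s) I a).
have disj := formally_disjointP D_disj C_sub.
have r2 : 2 * r <= 3 * r by have := r_gt0; lra.
have face k s z : closed_cube c (2 * r) z -> signed (~~ s) (z 0 k - c 0 k) = 2 * r ->
    ~ U k s z.
  move=> cz zk [a Fa Iaz].
  have [b bbe Ibz] : union_of I (be k s) (g z).
    apply: beP; exists z => //; split; last by rewrite zk.
    by move=> l; apply: le_trans (cz l) r2.
  exact: disj (Fbe _ _ _ _ Fa bbe) Iaz Ibz.
pose a0 : 'rV[R]_n := \row_k (c 0 k - 2 * r).
have KE (z : 'rV[R]_n) : (forall k, a0 0 k <= z 0 k <= a0 0 k + 2 * (2 * r)) ->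
    closed_cube c (2 * r) z.
  by move=> h; rewrite closed_cubeE => k; have := h k; rewrite mxE.
have [|||||z] := @cube_not_covered R n a0 (2 * (2 * r)) U.
- by have := r_gt0; lra.
- move=> k s; apply: (continuousP _).1 => //; apply: bigcup_open => a _.
  exact: basis_open.
- by move=> k z [a Fa Iaz] [b Fb]; apply: disj Iaz; apply: F01 Fa Fb.
- move=> k z /KE cz zk; apply: face => //; rewrite /= zk mxE; lra.
- move=> k z /KE cz zk; apply: face => //; rewrite /= zk mxE; lra.
move=> /KE cz nU; have [a qa Iaz] := Sq _ (gS z).
have [ai|aw|[k [s Fa]]] := hq a qa.
- by apply: nIS; exists (g z); rewrite -ai.
- have [b bw' Ibz] : union_of I w' (g z) by apply: w'c; exists z.
  exact: disj (ww' aw bw') Iaz Ibz.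
- by apply: (nU k s); exists a.
Qed.

(** Points of the large cube near [g y] lie in [I i]; all others are beyond [y] by at least [e] in
    some coordinate, on a side covered by some [u k s]. *)
Lemma certificate_complete i : I i `&` (g @` ball c r) !=set0 ->
  exists2 u : 'I_n -> bool -> seq nat,
    [/\ forall k a b, a \in u k false -> b \in u k true -> formally_disjoint C D a b &
        forall k s a b, a \in u k s -> b \in be k s -> formally_disjoint C D a b] &
    forall x, S x -> [\/ I i x, union_of I w x | exists k s, union_of I (u k s) x].
Proof.
case=> x [Iy [y cy yx]]; rewrite -{x}yx in Iy.
have /nbhs_ballP[e /= e0 he] : nbhs y (g @^-1` I i).
  by apply: contg; apply: basis_nbhs.
pose P k s := half k s (signed s (y 0 k - c 0 k) + e).
(* Since [y] is within r of the centre, the level of [P k s] exceeds - r. *)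
have PW k s : P k s `<=` half k s (- r).
  apply: image_subset; apply: half_cubeW.
  have /rV_ballP := cy; move=> /(_ r_gt0 k); rewrite ltr_norml => /andP[h1 h2].
  by case: s => /=; lra.
have sep k : exists u : bool -> seq nat, [/\ forall s, P k s `<=` union_of I (u s),
    forall a b, a \in u false -> b \in u true -> formally_disjoint C D a b &
    forall s a b, a \in u s -> b \in be k s -> formally_disjoint C D a b].
  (* The two levels add up to 2 e. *)
  have P01 x : P k false x -> ~ P k true x by apply: half_disjoint => /=; lra.
  have [u0 [u1 [Pu0 Pu1 u01]]] := compact_formal_separation I_basis D_sep C_meet
     (@compact_half k false _) (@compact_half k true _) P01.
  have ref s u : P k s `<=` union_of I u -> exists2 v, P k s `<=` union_of I v &
      forall a, a \in v -> (exists2 b, b \in u & clos C a b) /\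
        (exists2 b, b \in mu k s & clos C a b).
    move=> Pu; apply: (compact_refine I_basis C_meet (@compact_half k s _) Pu).
    exact: subset_trans (@PW k s) (@muP k s).
  have [v0 Pv0 hv0] := ref false u0 Pu0.
  have [v1 Pv1 hv1] := ref true u1 Pu1.
  exists (fun s => if s then v1 else v0); split.
  - by case.
  - move=> a b /hv0[[a' a'u aa'] _] /hv1[[b' b'u bb'] _].
    exact: formally_disjoint_clos aa' bb' (u01 _ _ a'u b'u).
  - case=> a b; [move=> /hv1|move=> /hv0] => -[_ [a' a'mu aa']] bbe;
      exact: formally_disjoint_clos aa' (clos_refl _ _) (mube a'mu bbe).
have /choice[u hu] := sep.
exists u; first by split=> k; have [] := hu k.
move=> x Sx; have [Ox|nOx] := pselect (O x); last first.
  by apply: Or32; apply: wS.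
have [z cz zx] := (OE Sx).1 Ox.
have [bz|nbz] := pselect (ball y e z); first by apply: Or31; rewrite -zx; apply: he.
apply: Or33; have [|k [s kz]] := @half_cube_cover R n c r y e z _ e0 nbz.
  have /rV_ballP := cz; rewrite mulr_gt0 // => /(_ isT) h k; exact/ltW/h.
exists k, s; have [Pu _ _] := hu k; apply: Pu; exists z => //.
Qed.

End chart_certificate.

(** * Enumeration of the basic sets near the point *)

Import Order.TTheory GRing.Theory Num.Theory.

Theorem theorem6p3 (R : realType) (fs : nat -> set nat)
    (hfs : cfv_enumeration fs)
    (X : topologicalType) (I : nat -> set X)
    (hX : computable_topological_space I)
    (S : set X) (hS : semicomputable I fs S)
    (x : X) (hx : S x)
    (hN : exists (n : nat) (N : set X),
        [/\ 0 < n, nbhd_in S x N & homeomorphic_to N 'rV[R]_n]) :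
  ce_at I S x.
Proof.
case: hN => n [N [_ [_ NS nbN] [f [g [cf cg gN gf fg]]]]].
case: hX => Ib [C [D [ceC ceD [Dd Cs Ds Cm]]]].
case: hS => cS ceS.
have [V0 /= + NV0] := (nbhs_subspace_ex N hx).1 nbN.
rewrite nbhsE => -[V [oV Vx] VV0].
have VSN : V `&` S `<=` N.
  move=> a [Va Sa]; have : (V0 `&` S) a by split=> //; apply: VV0.
  by rewrite -NV0 => -[].
have Nx : N x by apply: VSN.
pose c := f x; have gc : g c = x by apply: gf.
have injg : injective g := can_inj fg.
have gS z : S (g z) by apply: NS.
have /nbhs_ballP[r0 /= r0_gt0 hr0] : nbhs c (g @^-1` V).
  by apply: cg; rewrite gc; apply: open_nbhs_nbhs.
(* A quarter leaves room for the three cubes: 3 r is less than r0. *)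
pose r : R := (r0 / 4)%R.
have r_gt0 : (0 < r)%R by rewrite /r; lra.
have chart t : (t <= r0)%R ->
    exists2 O, open O & forall a, S a -> (O a <-> (g @` ball c t) a).
  move=> tr; apply: (chart_image_open cf gN gf fg oV VSN (ball_open c t)).
  by move=> _ [z cz <-]; apply: hr0; apply: le_ball cz.
(* Removing the open set [W3] from [S] leaves a compact set, to be covered by [w]; [W1] will show
   that the image of the small cube is a neighborhood of [x] in [S]. *)
have [W3 oW3 W3E] : exists2 O, open O & forall a, S a -> (O a <-> (g @` ball c (3 * r)%R) a).
  by apply: chart; rewrite /r; lra.
have [W1 oW1 W1E] : exists2 O, open O & forall a, S a -> (O a <-> (g @` ball c r) a).
  by apply: chart; rewrite /r; lra.
have compact_image (K : set 'rV[R]_n) : compact K -> compact (g @` K).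
  by move=> cK; apply: continuous_compact => //; apply: continuous_subspaceT.
have sep := compact_formal_separation Ib Ds Cm.
have [w [w' [Sw cw' ww']]] : exists w w', [/\ S `&` ~` W3 `<=` union_of I w,
    g @` closed_cube c (2 * r)%R `<=` union_of I w' &
    forall a b, a \in w -> b \in w' -> formally_disjoint C D a b].
  apply: sep; first by apply: compact_closedI => //; rewrite closedC.
    exact/compact_image/compact_closed_cube.
  move=> a [Sa nOa] [z cz za]; apply: nOa; apply/W3E => //; exists z => //.
  apply/rV_ballP => [|k]; first by lra.
  by apply: le_lt_trans (cz k) _; lra.
have sepks (ks : 'I_n * bool) : exists uv : seq nat * seq nat,
    [/\ g @` half_cube c r ks.1 ks.2 (- r)%R `<=` union_of I uv.1,
        g @` half_cube c r ks.1 (~~ ks.2) (2 * r)%R `<=` union_of I uv.2 &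
        forall a b, a \in uv.1 -> b \in uv.2 -> formally_disjoint C D a b].
  case: ks => k s /=; have [|||u [v h]] := sep (g @` half_cube c r k s (- r)%R)
      (g @` half_cube c r k (~~ s) (2 * r)%R).
  - exact/compact_image/compact_half_cube.
  - exact/compact_image/compact_half_cube.
  - move=> a [z hz <-] [z' hz' /injg zz']; rewrite zz' in hz'.
    by apply: half_cube_disjoint hz hz'; lra.
  by exists (u, v).
have /choice[uv huv] := sepks.
pose be k s := (uv (k, s)).2; pose mu k s := (uv (k, s)).1.
have beP k s : g @` half_cube c r k (~~ s) (2 * r)%R `<=` union_of I (be k s).
  by have [] := huv (k, s).
have muP k s : g @` half_cube c r k s (- r)%R `<=` union_of I (mu k s).
  by have [] := huv (k, s).
have mube k s a b : a \in mu k s -> b \in be k s -> formally_disjoint C D a b.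
  by have [_ _] := huv (k, s); apply.
(* The family has the single index 0; the dummy code has index 1 and stays invisible. *)
have [jw jwE] := fs_code_family hfs (fun=> w) 1.
have {}jwE a : fs jw (sqpair 0 a) <-> a \in w.
  by rewrite jwE; split=> [[[]|[]]//|]; left.
have [b0 b0E] := fs_code_ord_family hfs (be^~ false).
have [b1 b1E] := fs_code_ord_family hfs (be^~ true).
exists (g @` ball c r).
  split=> //; first by move=> _ [z _ <-].
  apply/nbhs_subspace_ex => //; exists W1.
    apply: open_nbhs_nbhs; split=> //; apply/W1E => //; exists c => //.
    exact: ballxx.
  by apply/seteqP; split=> a [h Sa]; split=> //; apply/W1E.
split; first by move=> _ [z _ <-].
have ceE := ce_formally_disjoint hfs ceC ceD.
have ceO := @ce_certificate fs hfs _ _ n jw b0 b1 ceS ceE.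
refine (ex_intro2 _ _ _ ceO _).
move=> i; split=> /=.
- move=> /(certificate_complete Ib Ds Cm cg injg r_gt0 W3E Sw muP mube).
  case=> u [u01 ube] Scov.
  have [j0 j0E] := fs_code_ord_family hfs (u^~ false).
  have [j1 j1E] := fs_code_ord_family hfs (u^~ true).
  (* All basic sets of the certificate are collected; they cover [S] by completeness. *)
  pose Q := i :: w ++ flatten [seq u k false ++ u k true | k <- enum 'I_n].
  have [q qE] : exists q, fs q = [set` Q].
    by apply: fs_onto => //; exists i; rewrite /= mem_head.
  exists q, j0, j1; split.
  + move=> a /Scov h; rewrite /finite_union qE.
    case: h => [ia|[b bw ba]|[k [s [b bu ba]]]].
    * by exists i => //=; rewrite mem_head.
    * by exists b => //=; rewrite inE mem_cat bw orbT.
    * exists b => //=; rewrite inE mem_cat; apply/orP; right; apply/orP; right.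
      apply/flatten_mapP; exists k; first by rewrite mem_enum.
      by rewrite mem_cat; case: s bu => ->; rewrite ?orbT.
  + move=> a; rewrite qE /= inE mem_cat => /predU1P[->|/orP[aw|]].
    * exact: Or31.
    * by apply: Or32; apply/jwE.
    * move=> /flatten_mapP[k _]; rewrite mem_cat => ku; apply: Or33.
      exists k; split=> //.
      by case/orP: ku => [/j0E|/j1E]; [left|right].
  + move=> k a kn; pose k' := Ordinal kn; rewrite -[k]/(nat_of_ord k') => /j0E au.
    split=> b; first by move=> /b0E; apply: ube au.
    by move=> /j1E; apply: u01 au.
  + move=> k a kn; pose k' := Ordinal kn; rewrite -[k]/(nat_of_ord k') => /j1E au b.
    by move=> /b1E; apply: ube au.
- case=> q [j0 [j1 [Sq hq h0 h1]]].
  pose F (k : 'I_n) (s : bool) : set nat := [set a | fs (if s then j1 else j0) (sqpair k a)].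
  apply: (certificate_sound Ib Dd Cs cg gS r_gt0 cw' ww' beP (F := F) Sq).
  + move=> a /hq[->|/jwE aw|[k [kn h]]]; [exact: Or31|exact: Or32|apply: Or33].
    by exists (Ordinal kn); case: h => h; [exists false|exists true].
  + by move=> k a b Fa Fb; have [_ h] := h0 k a (ltn_ord k) Fa; apply: h.
  + move=> k [] a b Fa; first by move=> /b1E; apply: h1 Fa _.
    by move=> /b0E; apply: (h0 k a (ltn_ord k) Fa).1.
Qed.
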